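(* Let $\mathcal{V}\to X$ be a rank-$2d$ complex vector bundle over a smooth manifold $X$, let $I\subset\mathbb{R}$ be an interval that is a neighborhood of $0$, and let $\omega(t)$, $t\in I$, be a family of fiberwise non-degenerate Hermitian symplectic forms on $\mathcal{V}$. Assume: (1) $\omega(t)$ depends continuously on $(x,t)\in X\times I$ and is uniformly $C^l$ in $t$ ($l\ge2$); (2) $\omega(0)=\omega_0$ and $\omega'(0)=0$, i.e. $\frac{d}{dt}\big|_{t=0}\omega(t)(u,v)=0$ for all $u,v$ in the same fiber. Then there exists a family of fiber-preserving bundle isomorphisms $F_t:\mathcal{V}\to\mathcal{V}$ (covering $\mathrm{id}_X$), depending continuously on $(x,t)\in X\times I$ and uniformly $C^{l-1}$ in $t$, such that $$F_t^*\omega(t)=\omega_0,\qquad F_0=\mathrm{id},\qquad \partial_t|_{t=0}F_t=0.$$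
   Context: A Hermitian symplectic form on a complex vector space is a form $\psi(\cdot,\cdot)$, conjugate-linear in the first and linear in the second argument, with $\psi(X,Y)=-\overline{\psi(Y,X)}$, which is non-degenerate (if $\psi(X,Y)=0$ for all $Y$, then $X=0$). $(F_t^*\omega(t))(u,v)=\omega(t)(F_tu,F_tv)$. ''Uniformly $C^l$ in $t$'' means that, in local trivializations of $\mathcal{V}$, the $t$-derivatives up to order $l$ exist and are continuous in $(x,t)$. *)

(* Defs.v *)
From HB Require Import structures.
From mathcomp Require Import all_boot all_order all_algebra.
From mathcomp Require Import complex.
From mathcomp Require Import all_classical all_reals all_analysis.

Set Implicit Arguments.
Unset Strict Implicit.
Unset Printing Implicit Defensive.

Import Order.TTheory GRing.Theory Num.Theory.
Import numFieldTopology.Exports numFieldNormedType.Exports.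

Local Open Scope classical_set_scope.
Local Open Scope complex_scope.
Local Open Scope ring_scope.

(* [R[i]] gets the topology of its norm [`|z|], as [numFieldTopology] does for
   abstract number fields; columns ['cV[R[i]]_r] then carry the usual topology
   of C^r. *)
#[non_forgetful_inheritance]
HB.instance Definition _ (R : realType) :=
  PseudoPointedMetric.copy R[i] R[i]^o.

Fixpoint Ck_on (R : realType) (n m k : nat) (A : set 'rV[R]_n)
    (f : 'rV[R]_n -> 'rV[R]_m) : Prop :=
  {within A, continuous f} /\
  match k with
  | 0%N => True
  | k'.+1 => forall v, (forall x, A x -> derivable f x v) /\
                       Ck_on k' A (fun x => 'D_v f x)
  end.

Definition smooth_on (R : realType) (n m : nat) (A : set 'rV[R]_n)
  (f : 'rV[R]_n -> 'rV[R]_m) : Prop := forall k, Ck_on k A f.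

(* [chart_map] is meaningful on [chart_dom] only, and [chart_inv] on the image
   of [chart_dom] only. *)
Record chart (R : realType) (X : topologicalType) (n : nat) := Chart {
  chart_dom : set X;
  chart_map : X -> 'rV[R]_n;
  chart_inv : 'rV[R]_n -> X }.

Definition chart_img (R : realType) (X : topologicalType) (n : nat)
  (c : chart R X n) : set 'rV[R]_n := chart_map c @` chart_dom c.

Definition is_chart (R : realType) (X : topologicalType) (n : nat)
    (c : chart R X n) : Prop :=
  [/\ open (chart_dom c) /\ open (chart_img c),
      forall x, chart_dom c x -> chart_inv c (chart_map c x) = x,
      {within chart_dom c, continuous (chart_map c)} &
      {within chart_img c, continuous (chart_inv c)}].

Definition compatible_charts (R : realType) (X : topologicalType) (n : nat)
    (c c' : chart R X n) : Prop :=
  smooth_on (chart_map c @` (chart_dom c `&` chart_dom c'))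
    (fun y => chart_map c' (chart_inv c y)).

Record smoothManifold (R : realType) := SmoothManifold {
  sm_space :> topologicalType;
  sm_dim : nat;
  sm_atlas : set (chart R sm_space sm_dim);
  sm_hausdorff : hausdorff_space sm_space;
  sm_countable : @second_countable sm_space;
  sm_chart : forall c, sm_atlas c -> is_chart c;
  sm_cover : forall x, exists2 c, sm_atlas c & chart_dom c x;
  sm_compatible : forall c c', sm_atlas c -> sm_atlas c' ->
    compatible_charts c c' }.

(* A space [fs_total] over [X] whose fiber over [x], [fs_proj @^-1` [set x]],
   is identified with the complex vector space [fs_fiber x] through the
   injection [fs_pt x]; [fs_vec e] is the vector corresponding to the point
   [e]. *)
Record fiberedSpace (R : realType) (X : topologicalType) := FiberedSpace {
  fs_fiber : X -> lmodType R[i];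
  fs_total : topologicalType;
  fs_proj : fs_total -> X;
  fs_pt : forall x, fs_fiber x -> fs_total;
  fs_vec : forall e, fs_fiber (fs_proj e);
  fs_proj_continuous : continuous fs_proj;
  fs_pt_inj : forall x, injective (@fs_pt x);
  fs_ptK : forall x (u : fs_fiber x), fs_proj (fs_pt u) = x;
  fs_vecK : forall e, fs_pt (fs_vec e) = e }.

(* Both families of maps are meaningful over [triv_dom] only. *)
Record trivialization (R : realType) (X : topologicalType)
    (V : fiberedSpace R X) (r : nat) := Trivialization {
  triv_dom : set X;
  triv_frame : forall x, 'cV[R[i]]_r -> fs_fiber V x;
  triv_coord : forall x, fs_fiber V x -> 'cV[R[i]]_r }.

(* [triv_frame] and [triv_coord] induce mutually inverse homeomorphisms between
   [triv_dom * C^r] and the part of the total space over [triv_dom]. *)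
Definition is_local_trivialization (R : realType) (X : topologicalType)
    (V : fiberedSpace R X) (r : nat) (T : trivialization V r) : Prop :=
  [/\ open (triv_dom T),
      forall x, triv_dom T x ->
        [/\ linear (@triv_frame _ _ _ _ T x),
            cancel (@triv_frame _ _ _ _ T x) (@triv_coord _ _ _ _ T x) &
            cancel (@triv_coord _ _ _ _ T x) (@triv_frame _ _ _ _ T x)],
      {within triv_dom T `*` setT, continuous
        (fun p : X * 'cV[R[i]]_r => fs_pt (triv_frame T p.1 p.2))} &
      {within @fs_proj _ _ V @^-1` triv_dom T, continuous
        (fun e : fs_total V => triv_coord T (fs_vec e))}].

(* Topological bundles; a smooth bundle is one by forgetting structure. *)
Record complexVectorBundle (R : realType) (X : topologicalType) (r : nat) :=
  ComplexVectorBundle {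
    vb_space :> fiberedSpace R X;
    vb_trivial : forall x, exists2 T : trivialization vb_space r,
      is_local_trivialization T & triv_dom T x }.

Definition hermitian_symplectic (R : realType) (W : lmodType R[i])
    (psi : W -> W -> R[i]) : Prop :=
  [/\ forall (a : R[i]) u v w, psi (a *: u + v) w = a^* * psi u w + psi v w,
      forall (a : R[i]) u v w, psi u (a *: v + w) = a * psi u v + psi u w,
      forall u v, psi u v = - (psi v u)^* &
      forall u, (forall v, psi u v = 0) -> u = 0].

(* The derivative relative to [I]: one-sided at an endpoint of [I] lying in
   [I]. *)
Definition has_deriv_in (R : realType) (I : set R) (f : R -> R[i]) (t : R)
    (df : R[i]) : Prop :=
  (fun s => ((s - t)^-1)%:C * (f s - f t)) s @[s --> within I t^'] --> df.

Fixpoint uniformly_Ck (R : realType) (X : topologicalType) (U : set X)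
    (I : set R) (k : nat) (f : X -> R -> R[i]) : Prop :=
  {within U `*` I, continuous (fun p : X * R => f p.1 p.2)} /\
  match k with
  | 0%N => True
  | k'.+1 => exists2 df : X -> R -> R[i],
      (forall x t, U x -> I t -> has_deriv_in I (f x) t (df x t)) &
      uniformly_Ck U I k' df
  end.

Section Families.
Variables (R : realType) (X : topologicalType) (r : nat).
Variables (V : complexVectorBundle R X r) (I : set R).

Definition form_family := R -> forall x, fs_fiber V x -> fs_fiber V x -> R[i].
Definition endo_family := R -> forall x, fs_fiber V x -> fs_fiber V x.

Definition form_coef (T : trivialization V r) (omega : form_family)
    (i j : 'I_r) (x : X) (t : R) : R[i] :=
  omega t x (triv_frame T x (delta_mx i 0)) (triv_frame T x (delta_mx j 0)).

Definition endo_coef (T : trivialization V r) (F : endo_family)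
    (i j : 'I_r) (x : X) (t : R) : R[i] :=
  triv_coord T (F t x (triv_frame T x (delta_mx j 0))) i 0.

Definition uniformly_Ck_form (k : nat) (omega : form_family) : Prop :=
  forall T : trivialization V r, is_local_trivialization T ->
  forall i j, uniformly_Ck (triv_dom T) I k (form_coef T omega i j).

Definition uniformly_Ck_endo (k : nat) (F : endo_family) : Prop :=
  forall T : trivialization V r, is_local_trivialization T ->
  forall i j, uniformly_Ck (triv_dom T) I k (endo_coef T F i j).

Definition continuous_form (omega : form_family) : Prop :=
  forall T : trivialization V r, is_local_trivialization T ->
  forall i j, {within triv_dom T `*` I, continuous
    (fun p : X * R => form_coef T omega i j p.1 p.2)}.

Definition continuous_endo (F : endo_family) : Prop :=
  {within setT `*` I, continuous
    (fun p : fs_total V * R => fs_pt (F p.2 _ (fs_vec p.1)))}.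

Definition bundle_map (f : forall x, fs_fiber V x -> fs_fiber V x)
    (e : fs_total V) : fs_total V := fs_pt (f _ (fs_vec e)).

Definition bundle_isomorphism (f : forall x, fs_fiber V x -> fs_fiber V x) :
    Prop :=
  [/\ forall x, linear (f x), continuous (bundle_map f) &
      exists g : forall x, fs_fiber V x -> fs_fiber V x,
        [/\ forall x, cancel (f x) (g x), forall x, cancel (g x) (f x) &
            continuous (bundle_map g)]].

Definition pullback (f : forall x, fs_fiber V x -> fs_fiber V x)
    (psi : forall x, fs_fiber V x -> fs_fiber V x -> R[i]) (x : X)
    (u v : fs_fiber V x) : R[i] := psi x (f x u) (f x v).

Definition form_deriv0 (omega : form_family) : Prop :=
  forall x (u v : fs_fiber V x), has_deriv_in I (fun t => omega t x u v) 0 0.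

(* The topology of the finite-dimensional fiber is read in coordinates. *)
Definition endo_deriv0 (F : endo_family) : Prop :=
  forall T : trivialization V r, is_local_trivialization T ->
  forall x (u : fs_fiber V x) i, triv_dom T x ->
    has_deriv_in I (fun t => triv_coord T (F t x u) i 0) 0 0.

End Families.

(* Main.v *)
(* Moser's trick. In a local trivialization [omega t] is an invertible matrix [W]
   with [W^* = - W]. Let [A = - W^-1 W' / 2] and let [F] solve the linear equation
   [F' = A F], [F 0 = 1]. Skewness gives [A^* W = W A = - W' / 2], so
   [(F^* W F)' = 0], that is, [F^* W F = W 0]. The same computation for two
   solutions [F] and [G] shows that [F^* W G] is constant, so that the solution is
   unique; it therefore does not depend on the trivialization. Existence comes from
   Picard iteration on compact intervals around 0, and continuity in the base point
   from Gronwall's inequality; differentiating [F' = A F] gives the regularity. *)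
Require Import Defs.
From mathcomp Require Import all_boot all_order all_algebra.
From mathcomp Require Import complex ring lra.
From mathcomp Require Import all_classical all_reals all_analysis.

Set Implicit Arguments.
Unset Strict Implicit.
Unset Printing Implicit Defensive.

Import Order.TTheory GRing.Theory Num.Theory.
Import numFieldTopology.Exports numFieldNormedType.Exports.

Local Open Scope classical_set_scope.
Local Open Scope ring_scope.

(** * Linear differential equations with parameters *)

(** [I] may contain its endpoints and need not be bounded, so derivatives can be one-sided and the
    coefficients of the equation need not be bounded on [I]. The real system is therefore solved on
    the whole line, with two-sided derivatives, after its coefficients are frozen outside a compact
    segment of [I]. Solutions for different segments agree where both solve the original equation,
    and so they glue to a solution on [I] with derivatives relative to [I].

    Two uniqueness arguments occur: Gronwall's inequality for this gluing, and the conserved matrix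
    [F^* W G] for the comparison of frames.

    Invertibility of [F] comes for free from [F^* W F = W 0]. One derivative is lost because [A]
    contains [W'], and [F'(0) = 0] because [A(0) = 0].

    The endomorphism over [x] is defined through an arbitrary trivialization around [x], with no
    regularity in the choice. A change of frame [G] turns [W] into [G^* W G] and a solution [F] into
    [G^-1 F G]; every trivialization thus sees its own solution, and continuity can be checked
    there. *)

Section RealAnalysis.
Context {R : realType}.
Implicit Types (f g : R -> R) (a b t : R).

(** To cover the whole line, the integral starts at a point that moves with [t]. Subtracting the
    integral up to 0 makes the value independent of the starting point, so near a given [t] a fixed
    one can be used and the fundamental theorem applies. *)
Lemma exists_primitive f : continuous f ->
  exists2 F : R -> R, F 0 = 0 & forall t, is_derive t 1 F (f t).
Proof.
move=> cf.
pose G a x := (\int[lebesgue_measure]_(y in `[a, x]) f y)%R.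
have fi a x : lebesgue_measure.-integrable `[a, x] (EFin \o f).
  apply: continuous_compact_integrable; first exact: segment_compact.
  exact: continuous_subspaceT.
have GB a c x : a <= c -> c <= x -> G a x - G a c = G c x.
  move=> ac cx; rewrite /G Rintegral_itvB ?bnd_simp//.
  rewrite Rintegral_itv_obnd_cbnd//; last first.
  by apply: integrableS (fi c x) => //; apply: subset_itv; rewrite bnd_simp.
pose F t := G (- (`|t| + 1)) t - G (- (`|t| + 1)) 0.
exists F => [|t]; first by rewrite /F subrr.
(* Every [x] at distance at most 1 from [t] satisfies [|x| + 1 <= c], so [- c] is a common starting
   point near [t]. *)
pose c := `|t| + 2.
have Fc x : `|x| + 1 <= c -> F x = G (- c) x - G (- c) 0.
  move=> xc; have cx : - c <= - (`|x| + 1) by rewrite lerN2.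
  have x1 : - (`|x| + 1) <= x by have := ler_norm (- x); rewrite normrN; lra.
  have x0 : - (`|x| + 1) <= 0 by have := normr_ge0 x; lra.
  by rewrite /F -(GB (- c) _ _ cx x1) -(GB (- c) _ _ cx x0); lra.
have ct : - c < t by have := ler_norm (- t); rewrite normrN /c; lra.
have [] := @continuous_FTC1_closed R f (- c) t (t + 1) ltac:(lra) (fi _ _) ct (cf t).
rewrite -/(G (- c)) derive1E => dG eG.
have : is_derive t (1 : R) (fun x => G (- c) x - G (- c) 0) (f t).
  rewrite -[f t]subr0; apply: is_deriveB.
  by rewrite -eG; apply: DeriveDef.
apply: near_eq_is_derive.
near=> x; rewrite Fc//.
have xt : `|x - t| <= 1.
  near: x; have := @nbhsx_ballx _ _ t 1 ltac:(lra).
  by apply: filterS => x; rewrite /ball/= distrC => /ltW.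
by rewrite /c; have := ler_normD (x - t) t; rewrite subrK; lra.
Unshelve. all: by end_near. Qed.

Lemma derive_le_increment f g df dg a b : a <= b ->
  (forall t, is_derive t 1 f (df t)) -> (forall t, is_derive t 1 g (dg t)) ->
  (forall t, a <= t <= b -> df t <= dg t) -> f b - f a <= g b - g a.
Proof.
move=> ab dF dG le.
have dgf t : is_derive t 1 (fun x => g x - f x) (dg t - df t) by apply: is_deriveB.
have [//|c cab] := @MVT_segment R (fun x => g x - f x) _ a b ab (fun t _ => dgf t).
  apply: derivable_within_continuous => t _.
  by apply: ex_derive; exact: dgf.
move=> e; suff : 0 <= (g b - f b) - (g a - f a) by lra.
rewrite e mulr_ge0 ?subr_ge0//; apply: le.
by move: cab; rewrite in_itv.
Qed.


(** The sequences [u n - 2 D / 2^n] and [u n + 2 D / 2^n] are respectively nondecreasing and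
    nonincreasing, and the first stays below the second. The supremum of the first is the limit,
    with an explicit error at every rank. *)
Lemma cvg_of_geometric_increments (u : nat -> R) D :
  (forall n, `|u n.+1 - u n| <= D / 2 ^+ n) ->
  exists l, forall n, `|l - u n| <= 2 * D / 2 ^+ n.
Proof.
move=> uD.
pose lo n := u n - 2 * D / 2 ^+ n.
pose hi n := u n + 2 * D / 2 ^+ n.
have half n : 2 * D / 2 ^+ n.+1 = D / 2 ^+ n.
  by rewrite exprS invfM mulrA; congr (_ / _); rewrite mulrAC mulfV ?mul1r// pnatr_eq0.
have D0 : 0 <= D by have := le_trans (normr_ge0 _) (uD 0%N); rewrite expr0 divr1.
have loS : {homo lo : m n / (m <= n)%N >-> m <= n}.
  apply: homo_leq => [x|x y z|n]; [exact: lexx|exact: le_trans|].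
  have := uD n; rewrite /lo half ler_norml; lra.
have hiS : {homo hi : m n / (m <= n)%N >-> m >= n}.
  apply: homo_leq => [x|x y z xy yz|n]; [exact: lexx|exact: (le_trans yz xy)|].
  have := uD n; rewrite /hi half ler_norml; lra.
have lohi m n : lo m <= hi n.
  apply: (le_trans (loS _ _ (leq_maxl m n))).
  apply: le_trans (hiS _ _ (leq_maxr m n)).
  have : 0 <= D / 2 ^+ maxn m n by rewrite divr_ge0// exprn_ge0.
  by rewrite /lo /hi; lra.
have ublo n : ubound (range lo) (hi n) by move=> _ [m _ <-].
have sublo : has_sup (range lo).
  by split; [exists (lo 0%N), 0%N|exists (hi 0%N)].
exists (sup (range lo)) => n.
have : lo n <= sup (range lo) by apply: sup_upper_bound => //; exists n.
have : sup (range lo) <= hi n by apply: ge_sup => //; exists (lo 0%N), 0%N.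
by rewrite /lo /hi ler_norml; lra.
Qed.

Lemma eq0_of_le_geometric (x c : R) : (forall n, `|x| <= c / 2 ^+ n) -> x = 0.
Proof.
move=> xc; apply/eqP; rewrite -normr_eq0; apply: contraT => x0.
have {}x0 : 0 < `|x| by rewrite lt_neqAle eq_sym x0 /=.
have [n cn] : exists n : nat, c / `|x| < n%:R.
  exists (Num.bound (c / `|x|)); apply: le_lt_trans (archi_boundP _) => //.
  by apply: divr_ge0 => //; have := xc 0%N; rewrite expr0 divr1; exact: le_trans.
have := xc n; rewrite ler_pdivlMr ?exprn_gt0// leNgt mulrC => /negP[].
rewrite -ltr_pdivrMr// (lt_trans cn)// -natrX ltr_nat.
exact: ltn_expl.
Qed.

End RealAnalysis.

Section LinearODE.
Context {R : realType}.
Implicit Types (t a b c x : R).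
Lemma is_derive_mulR (f g : R -> R) (t df dg : R) :
  is_derive t 1 f df -> is_derive t 1 g dg ->
  is_derive t 1 (fun x => f x * g x) (df * g t + f t * dg).
Proof.
move=> dF dG; apply: (is_derive_eq (is_deriveM dF dG)).
by rewrite /GRing.scale/= addrC (mulrC (g t)).
Qed.

Lemma is_derive_sumR (K : finType) (f : K -> R -> R) (t : R) (df : K -> R) :
  (forall i, is_derive t 1 (f i) (df i)) ->
  is_derive t 1 (fun x => \sum_i f i x) (\sum_i df i).
Proof.
move=> dF; elim: (index_enum K) => [|i s ih].
  by rewrite big_nil; under eq_fun do rewrite big_nil; exact: is_derive_cst.
by rewrite big_cons; under eq_fun do rewrite big_cons; exact: is_deriveD.
Qed.

Lemma is_derive_expRM (c t : R) :
  is_derive t 1 (fun x => expR (c * x)) (c * expR (c * t)).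
Proof.
have h : is_derive t 1 (fun x : R => c * x) c.
  by apply: is_derive_eq; rewrite /GRing.scale/= mulr1.
have := is_derive1_comp (is_derive_expR (c * t)) h.
by rewrite mulrC.
Qed.

(** * Picard iteration with bounded coefficients on the whole line *)

Section Picard.
Variables (K : finType) (B : K -> K -> R -> R) (M : R) (y0 : K -> R).
Hypothesis B_cont : forall i j, continuous (B i j).
Hypothesis B_le : forall i j t, `|B i j t| <= M.

(** Half of [L] dominates [#|K| * M], the Lipschitz constant of the right-hand side for the sup
    norm; the added 1 keeps [L] positive when [K] is empty or [M] is 0. *)
Let L := 2 * (#|K|%:R * M + 1).
(* For this weight the Picard map is a contraction of ratio 1/2 on the whole line. *)
Let weight t := expR (L * t) + expR (- L * t).

Let KM_ge0 : 0 <= #|K|%:R * M.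
Proof.
case: (pickP (@predT K)) => [i _|K0]; last by rewrite (eq_card0 K0) mul0r.
by rewrite mulr_ge0// (le_trans _ (B_le i i 0)).
Qed.

Let L_gt0 : 0 < L. Proof. by rewrite /L; have := KM_ge0; lra. Qed.

Let weight_ge1 t : 1 <= weight t.
Proof.
rewrite /weight; have := expR_ge1Dx (L * t); have := expR_ge1Dx (- L * t).
by lra.
Qed.

Let weight_primitive (t : R) : is_derive t 1
  (fun x => L^-1 * (expR (L * x) - expR (- L * x))) (weight t).
Proof.
have d1 := is_derive_expRM L t.
have d2 := is_derive_expRM (- L) t.
apply: (is_derive_eq (is_derive_mulR (is_derive_cst L^-1 t 1) (is_deriveB d1 d2))).
rewrite /weight /=; field.
by rewrite gt_eqF.
Qed.

(** The primitive of [weight] that vanishes at 0 is a difference of the same two exponentials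
    divided by [L], hence bounded by [weight / L]. Comparing increments on either side of 0
    transfers this bound to [f]: integration gains the factor [1 / L]. *)
Lemma primitive_le_weight (f df : R -> R) c : 0 <= c -> f 0 = 0 ->
  (forall t, is_derive t 1 f (df t)) ->
  (forall t, `|df t| <= c * weight t) ->
  forall t, `|f t| <= c * weight t / L.
Proof.
move=> c0 f0 dF dfc t.
pose g x := c * (L^-1 * (expR (L * x) - expR (- L * x))).
have g0 : g 0 = 0 by rewrite /g !mulr0 subrr !mulr0.
have dg x : is_derive x 1 g (c * weight x).
  apply: (is_derive_eq (is_derive_mulR (is_derive_cst c x 1) (weight_primitive x))).
  by rewrite mul0r add0r.
have dNg x : is_derive x 1 (- g) (- (c * weight x)) by apply: is_deriveN.
have gle : `|g t| <= c * weight t / L.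
  rewrite /g -mulrA normrM (ger0_norm c0) ler_wpM2l//.
  rewrite normrM [`|L^-1|]gtr0_norm ?invr_gt0// mulrC ler_wpM2r ?invr_ge0 ?(ltW L_gt0)//.
  rewrite /weight (le_trans (ler_normB _ _))// !ger0_norm ?expR_ge0//.
apply: le_trans gle.
have h1 a b : a <= b -> f b - f a <= g b - g a.
  move=> ab; apply: (derive_le_increment ab dF dg) => x _.
  by have := dfc x; rewrite ler_norml => /andP[].
have h2 a b : a <= b -> - g b - - g a <= f b - f a.
  move=> ab; apply: (derive_le_increment ab dNg dF) => x _.
  by have := dfc x; rewrite ler_norml => /andP[].
have [t0|t0] := leP 0 t.
  have := h1 _ _ t0; have := h2 _ _ t0; rewrite f0 g0 => e1 e2.
  apply: (@le_trans _ _ (g t)); last exact: ler_norm.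
  by rewrite ler_norml; lra.
have := h1 _ _ (ltW t0); have := h2 _ _ (ltW t0); rewrite f0 g0 => e1 e2.
rewrite -normrN; apply: (@le_trans _ _ (- g t)); last by rewrite -(normrN (g t)) ler_norm.
by rewrite normrN ler_norml; lra.
Qed.

Let rhs (y : K -> R -> R) i t := \sum_j B i j t * y j t.

Let rhs_cont (y : K -> R -> R) i : (forall j, continuous (y j)) -> continuous (rhs y i).
Proof.
move=> cy t; apply: (cvg_big add_continuous) => j _.
by apply: cvgM; [exact: B_cont|exact: cy].
Qed.

Let rhs_le y c i t : (forall j, `|y j t| <= c) -> `|rhs y i t| <= c * (L / 2).
Proof.
move=> yc; apply: (le_trans (ler_norm_sum _ _ _)).
have c0 : 0 <= c by rewrite (le_trans _ (yc i)).
apply: (@le_trans _ _ (\sum_(j : K) M * c)).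
  by apply: ler_sum => j _; rewrite normrM ler_pM.
rewrite sumr_const -mulr_natl -[X in X <= _]mulr_natl.
by rewrite /L; have := KM_ge0; nra.
Qed.

Lemma linear_ode_bounded : exists2 y : K -> R -> R,
  forall i, y i 0 = y0 i & forall i t, is_derive t 1 (y i) (\sum_j B i j t * y j t).
Proof.
(* Primitives vanishing at 0, as a total operator; the value 0 at a discontinuous function is a mere
   default. *)
have /choice[P PP] : forall f : R -> R, exists F : R -> R, continuous f ->
    F 0 = 0 /\ forall t, is_derive t 1 F (f t).
  move=> f; have [/exists_primitive[F F0 dF]|nf] := pselect (continuous f); first by exists F.
  by exists 0.
pose S := fix S n : K -> R -> R := if n is n'.+1 then
  fun i t => y0 i + P (rhs (S n') i) t else fun i _ => y0 i.
have derivable_cont (f df : R -> R) : (forall t, is_derive t 1 f (df t)) -> continuous f.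
  move=> dF t; apply: differentiable_continuous.
  by apply/derivable1_diffP; apply: ex_derive; exact: dF.
have dP (y : K -> R -> R) i : (forall j, continuous (y j)) ->
    forall t, is_derive t 1 (fun t => y0 i + P (rhs y i) t) (rhs y i t).
  move=> cy t; rewrite -[rhs y i t]add0r; apply: is_deriveD.
  by apply: (PP _ _).2; exact: rhs_cont.
have S_cont n : forall i, continuous (S n i).
  elim: n => [|n ih] i; first by move=> t; exact: cvg_cst.
  exact: derivable_cont (dP _ _ ih).
pose C := \sum_i `|y0 i|.
have C0 : 0 <= C by apply: sumr_ge0.
(* The contraction: the right-hand side costs a factor [L / 2], integration gains [1 / L]. *)
have step (y z : K -> R -> R) c i :
    0 <= c -> (forall j, continuous (y j)) -> (forall j, continuous (z j)) ->
    (forall j t, `|y j t - z j t| <= c * weight t) ->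
    forall t, `|P (rhs y i) t - P (rhs z i) t| <= c * weight t / 2.
  move=> c_ge0 cy cz yz t.
  have [Py0 dPy] := PP _ (@rhs_cont _ i cy).
  have [Pz0 dPz] := PP _ (@rhs_cont _ i cz).
  have dyz x : is_derive x 1 (fun x => P (rhs y i) x - P (rhs z i) x)
      (rhs y i x - rhs z i x) by apply: is_deriveB.
  have -> : c * weight t / 2 = c * (L / 2) * weight t / L.
    by field; rewrite gt_eqF.
  apply: (primitive_le_weight _ _ dyz); first by rewrite mulr_ge0// divr_ge0// ltW.
    by rewrite Py0 Pz0 subrr.
  move=> x; rewrite mulrAC.
  have -> : rhs y i x - rhs z i x = rhs (fun j t => y j t - z j t) i x.
    by rewrite /rhs -sumrB; apply: eq_bigr => j _; rewrite mulrBr.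
  exact: rhs_le.
have S_step n : forall i t, `|S n.+1 i t - S n i t| <= C * weight t / 2 ^+ n.
  elim: n => [|n ih] i t.
    rewrite expr0 divr1 /= addrC addKr.
    have [Py0 dPy] := PP _ (@rhs_cont _ i (S_cont 0%N)).
    have -> : C * weight t = C * L * weight t / L by field; rewrite gt_eqF.
    apply: (primitive_le_weight _ _ dPy) => //; first by rewrite mulr_ge0// ltW.
    move=> x; apply: (@le_trans _ _ (C * (L / 2))).
      apply: rhs_le => j; rewrite /C (bigD1 j)//= lerDl.
      by apply: sumr_ge0.
    have := weight_ge1 x; have : 0 <= C * L by rewrite mulr_ge0// ltW.
    by nra.
  rewrite /= opprD addrACA subrr add0r exprS invfM.
  have -> : C * weight t * (2^-1 * (2 ^+ n)^-1) = C / 2 ^+ n * weight t / 2.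
    by field; rewrite expf_neq0.
  apply: (step _ _ _ i _ (S_cont n.+1) (S_cont n)) => [|j x].
    by rewrite divr_ge0// exprn_ge0.
  by rewrite mulrAC; exact: ih.
have /choice[s sP] : forall i, exists s : R -> R, forall t n,
    `|s t - S n i t| <= 2 * (C * weight t) / 2 ^+ n.
  move=> i.
  have /choice[s sP] : forall t, exists l, forall n,
      `|l - S n i t| <= 2 * (C * weight t) / 2 ^+ n.
    by move=> t; apply: cvg_of_geometric_increments => n; exact: S_step.
  by exists s.
have weight_cont : continuous weight.
  move=> t; apply: cvgD.
    exact: derivable_cont (is_derive_expRM L) _.
  exact: derivable_cont (is_derive_expRM (- L)) _.
have s_cont i : continuous (s i).
  move=> t; apply/cvgrPdist_le => e e0.
  (* Near [t] the weight is at most [weight t + 1], so the convergence is locally uniform with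
     constant [D] and the limit inherits continuity. *)
  pose D := 2 * (C * (weight t + 1)).
  have [n Dn] : exists n, D / 2 ^+ n <= e / 3.
    apply: contrapT => /forallNP nD.
    have e30 : e / 3 = 0.
      apply: (@eq0_of_le_geometric _ _ D) => n; rewrite ger0_norm; last by lra.
      by have /negP := nD n; rewrite -ltNge => /ltW.
    by lra.
  near=> x.
  have xD : `|s i x - S n i x| <= e / 3.
    apply: (le_trans (sP i x n)); apply: le_trans Dn.
    rewrite ler_pM2r ?invr_gt0 ?exprn_gt0// ler_pM2l// ler_wpM2l//.
    near: x; move/cvgrPdist_le : (weight_cont t) => /(_ 1 ltr01).
    by apply: filterS => x; rewrite ler_norml; lra.
  have tD : `|s i t - S n i t| <= e / 3.
    apply: (le_trans (sP i t n)); apply: le_trans Dn.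
    by rewrite ler_pM2r ?invr_gt0 ?exprn_gt0// ler_pM2l// ler_wpM2l// lerDl.
  have Sx : `|S n i t - S n i x| <= e / 3.
    near: x; move/cvgrPdist_le : (S_cont n i t); apply; lra.
  by move: xD tD Sx; rewrite !ler_norml; lra.
(* Both the limit and its Picard image lie within [C * weight t / 2^n] of the iterate [S n.+1], for
   every [n]. *)
have s_eq i t : s i t = y0 i + P (rhs s i) t.
  apply/eqP; rewrite -subr_eq0; apply/eqP.
  apply: (@eq0_of_le_geometric _ _ (2 * (C * weight t))) => n.
  have h1 := sP i t n.+1.
  have h2 : `|P (rhs s i) t - P (rhs (S n) i) t| <= 2 * C / 2 ^+ n * weight t / 2.
    apply: (step _ _ _ i _ s_cont (S_cont n)) => [|j x].
      by rewrite divr_ge0 ?mulr_ge0// exprn_ge0.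
    by rewrite mulrAC -(mulrA 2); exact: sP.
  have e1 : 2 * (C * weight t) / 2 ^+ n.+1 = C * weight t / 2 ^+ n.
    by rewrite exprS; field; rewrite expf_neq0.
  have e2 : 2 * C / 2 ^+ n * weight t / 2 = C * weight t / 2 ^+ n.
    by field; rewrite expf_neq0.
  have -> : 2 * (C * weight t) / 2 ^+ n = C * weight t / 2 ^+ n + C * weight t / 2 ^+ n.
    by rewrite -mulrDl; congr (_ / _); lra.
  move: h1 h2; rewrite e1 e2 /= !ler_norml; lra.
have sE i : s i = fun t => y0 i + P (rhs s i) t by apply/funext => t; exact: s_eq.
exists s => i.
  by rewrite s_eq (PP _ (@rhs_cont _ i s_cont)).1 addr0.
by move=> t; rewrite [X in is_derive _ _ X]sE; exact: dP.
Unshelve. all: by end_near. Qed.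

End Picard.
End LinearODE.

(** * Gronwall's inequality *)

Section Gronwall.
Context {R : realType}.
Implicit Types (s t a b c : R).

(** The sum of squares is used because, unlike a sum of absolute values, it is differentiable.
    Adding the constant [#|K| * d^2] absorbs the inhomogeneous term: the resulting [psi] satisfies
    [|psi'| <= L * psi] and starts at [#|K| * d^2], so it grows at most exponentially away from 0 in
    both directions. *)
Lemma gronwall (K : finType) (w dw : K -> R -> R) (M d a b : R) :
  0 <= M -> 0 <= d -> a <= 0 <= b ->
  (forall i, w i 0 = 0) -> (forall i t, is_derive t 1 (w i) (dw i t)) ->
  (forall i t, a <= t <= b -> `|dw i t| <= M * (\sum_j `|w j t|) + d) ->
  forall i t, a <= t <= b ->
  w i t ^+ 2 <= d ^+ 2 * (#|K|%:R * expR ((2 * #|K|%:R * M + 1) * (b - a))).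
Proof.
move=> M0 d0 /andP[a0 b0] w0 dW wd i t /andP[at_ tb].
pose N : R := #|K|%:R.
pose L := 2 * N * M + 1.
have L0 : 0 <= L by rewrite /L addr_ge0// !mulr_ge0// ler0n.
pose psi s := \sum_i (w i s) * (w i s) + N * d ^+ 2.
pose dpsi s := \sum_i (dw i s * w i s + w i s * dw i s).
have dPsi s : is_derive s 1 psi (dpsi s).
  rewrite -[dpsi s]addr0; apply: is_deriveD.
  by apply: is_derive_sumR => j; exact: is_derive_mulR.
have dpsi_le s : a <= s <= b -> `|dpsi s| <= L * psi s.
  move=> sab; apply: (le_trans (ler_norm_sum _ _ _)).
  (* The bounds [2 |w_i| |w_j| <= w_i^2 + w_j^2] and [2 d |w_i| <= w_i^2 + d^2], summed over all
     indices, produce exactly [L] times the sum of squares, plus [N * d^2]. *)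
  apply: (@le_trans _ _ (\sum_i (\sum_j M * (w i s * w i s + w j s * w j s)
      + (w i s * w i s + d ^+ 2)))).
    apply: ler_sum => j _.
    have -> : dw j s * w j s + w j s * dw j s = 2 * dw j s * w j s by lra.
    rewrite normrM normrM (ger0_norm (ler0n _ 2)).
    have h := wd j s sab.
    have aw (k : K) : w k s * w k s = `|w k s| * `|w k s|.
      by rewrite -normrM ger0_norm// -expr2 sqr_ge0.
    have h2 : 2 * (M * (\sum_k `|w k s|)) * `|w j s| <=
        \sum_k M * (w j s * w j s + w k s * w k s).
      rewrite mulr_sumr mulr_sumr mulr_suml; apply: ler_sum => k _.
      rewrite !aw; have := sqr_ge0 (`|w j s| - `|w k s|).
      rewrite expr2 => h3.
      have : 0 <= M * ((`|w j s| - `|w k s|) * (`|w j s| - `|w k s|)) by rewrite mulr_ge0.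
      by lra.
    have h3 : 2 * d * `|w j s| <= w j s * w j s + d ^+ 2.
      rewrite aw; have := sqr_ge0 (`|w j s| - d); rewrite !expr2; lra.
    have h4 : 2 * `|dw j s| * `|w j s| <= 2 * (M * (\sum_k `|w k s|) + d) * `|w j s|.
      by rewrite ler_wpM2r// ler_pM2l.
    by lra.
  set S := \sum_(i0 : K) w i0 s * w i0 s.
  have e1 (j : K) : \sum_k M * (w j s * w j s + w k s * w k s) = M * (N * (w j s * w j s) + S).
    by rewrite -mulr_sumr big_split/= sumr_const -mulr_natl.
  under eq_bigr => j _ do rewrite e1.
  rewrite big_split/= -mulr_sumr !big_split/= -mulr_sumr !sumr_const -/S.
  rewrite -[S *+ _]mulr_natl -[d ^+ 2 *+ _]mulr_natl -/N /psi -/S /L.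
  have : 0 <= N * M * (N * d ^+ 2).
    by rewrite !mulr_ge0 ?ler0n ?sqr_ge0.
  by lra.
have psi0 : psi 0 = N * d ^+ 2.
  by rewrite /psi big1 ?add0r// => j _; rewrite w0 mulr0.
have wpsi s : w i s ^+ 2 <= psi s.
  rewrite /psi (bigD1 i)//= expr2 -addrA lerDl addr_ge0//.
    by apply: sumr_ge0 => j _; rewrite -expr2 sqr_ge0.
  by rewrite mulr_ge0 ?ler0n ?sqr_ge0.
have psi_ge0 s : 0 <= psi s by apply: le_trans (wpsi s); rewrite sqr_ge0.
have dexp (c s : R) : is_derive s 1 (fun x => psi x * expR (c * x))
   ((dpsi s + c * psi s) * expR (c * s)).
  apply: (is_derive_eq (is_derive_mulR (dPsi s) (is_derive_expRM c s))).
  by rewrite [RHS]mulrDl; congr (_ + _); rewrite mulrCA mulrA.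
have dcst (s : R) : is_derive s 1 (fun _ : R => 0 : R) 0 by exact: is_derive_cst.
suff main : psi t <= psi 0 * expR (L * (b - a)).
  apply: (le_trans (wpsi t)); apply: (le_trans main).
  by rewrite psi0 mulrAC mulrC.
have [t0|/ltW t0] := leP 0 t.
  have : psi t * expR (- L * t) <= psi 0.
    have := @derive_le_increment _ _ _ _ _ _ _ t0 (dexp (- L)) dcst.
    rewrite mulr0 expR0 mulr1 subrr subr_le0; apply => s /andP[s0 st].
    rewrite -[leRHS](mul0r (expR (- L * s))) ler_pM2r ?expR_gt0//.
    have : a <= s <= b by lra.
    by move/dpsi_le; rewrite ler_norml; lra.
  rewrite mulNr expRN ler_pdivrMr ?expR_gt0// => h; apply: (le_trans h).
  by rewrite ler_wpM2l// ler_expR ler_wpM2l//; lra.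
have : psi t * expR (L * t) <= psi 0.
  have := @derive_le_increment _ _ _ _ _ _ _ t0 dcst (dexp L).
  rewrite mulr0 expR0 mulr1 subrr subr_ge0; apply => s /andP[s0 st].
  rewrite -[leLHS](mul0r (expR (L * s))) ler_pM2r ?expR_gt0//.
  have : a <= s <= b by lra.
  by move/dpsi_le; rewrite ler_norml; lra.
have psi0E : psi 0 = psi 0 * expR (- L * t) * expR (L * t).
  by rewrite mulNr expRN mulfVK// gt_eqF// expR_gt0.
rewrite {1}psi0E ler_pM2r ?expR_gt0// => h; apply: (le_trans h).
rewrite ler_wpM2l// ler_expR mulNr -mulrN ler_wpM2l//; lra.
Qed.

End Gronwall.

(** * Real derivatives relative to an interval *)

Section OneSidedDerivatives.
Context {R : realType}.
Implicit Types (s t a b c df : R) (I : set R).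

Definition has_real_deriv_in I (f : R -> R) t df : Prop :=
  (fun s => (s - t)^-1 * (f s - f t)) s @[s --> within I t^'] --> df.

Lemma is_derive_has_real_deriv_in I (f : R -> R) t df :
  is_derive t 1 f df -> has_real_deriv_in I f t df.
Proof.
move=> [/cvgrPdist_le dF dfE]; move: dF; rewrite -/('D_1 f t) dfE => dF.
apply/cvgrPdist_le => e /dF /nbhs_ballP[d d0 H].
apply/nbhs_ballP; exists d => // s sd st _.
have := H (s - t); rewrite /= subr_eq0 => /(_ _ st).
rewrite /GRing.scale/= mulr1 subrK; apply.
by rewrite /ball/= sub0r normrN distrC.
Qed.

Lemma eq_has_real_deriv_in I (f g : R -> R) t df : f t = g t ->
  (\forall s \near t, I s -> f s = g s) ->
  has_real_deriv_in I f t df -> has_real_deriv_in I g t df.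
Proof.
move=> ft fg; apply: cvg_trans; apply: near_eq_cvg.
rewrite !near_withinE; apply: filterS fg => s fg _ Is.
by rewrite /= -fg// ft.
Qed.

(** Serves to answer local questions at [t] on one compact segment of [I] containing 0. If [I] has a
    point to the left of [t], that point or 0 can be the left end; otherwise [t] is the minimum of
    [I], and points near [t] that lie in [I] are not to its left. The right end is symmetric. *)
Lemma interval_core I t : is_interval I -> I 0 -> I t ->
  exists a b, [/\ I a, I b, a <= 0 <= b, a <= t <= b &
    \forall s \near t, I s -> a <= s <= b].
Proof.
move=> itvI I0 It.
have lo : exists a, [/\ I a, a <= 0, a <= t & \forall s \near t, I s -> a <= s].
  have [[c Ic ct]|noc] := pselect (exists2 c, I c & c < t).
    exists (Num.min 0 c); rewrite !ge_min lexx (ltW ct) orbT; split=> //.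
      by rewrite minEle; case: ifP.
    near=> s => _; rewrite ge_min; apply/orP; right; apply/ltW.
    by near: s; exact: lt_nbhsr.
  exists (Num.min 0 t); rewrite !ge_min !lexx orbT; split=> //.
    by rewrite minEle; case: ifP.
  near=> s => Is; rewrite ge_min; apply/orP; right; rewrite leNgt; apply/negP => st.
  by apply: noc; exists s.
have hi : exists b, [/\ I b, 0 <= b, t <= b & \forall s \near t, I s -> s <= b].
  have [[c Ic ct]|noc] := pselect (exists2 c, I c & t < c).
    exists (Num.max 0 c); rewrite !le_max lexx (ltW ct) orbT; split=> //.
      by rewrite maxEle; case: ifP.
    near=> s => _; rewrite le_max; apply/orP; right; apply/ltW.
    by near: s; exact: lt_nbhsl.
  exists (Num.max 0 t); rewrite !le_max !lexx orbT; split=> //.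
    by rewrite maxEle; case: ifP.
  near=> s => Is; rewrite le_max; apply/orP; right; rewrite leNgt; apply/negP => st.
  by apply: noc; exists s.
have [a [Ia a0 at_ na]] := lo; have [b [Ib b0 tb nb]] := hi.
exists a, b; split; rewrite ?a0 ?b0 ?at_ ?tb//.
by apply: filterS2 na nb => s h1 h2 Is; rewrite h1 ?h2.
Unshelve. all: by end_near. Qed.

(** Compactness of [K] makes the neighborhood of [x0] independent of [t]. The tolerance is halved
    because [f x] and [f x0] are both compared with the value of [f x0] at the centre of a covering
    neighborhood. *)
Lemma tube_cvg (X : topologicalType) (U : set X) I (K : set R) (f : X -> R -> R) x0 e :
  {within U `*` I, continuous (fun p : X * R => f p.1 p.2)} ->
  compact K -> K `<=` I -> U x0 -> 0 < e ->
  \forall x \near x0, U x -> forall t, K t -> `|f x t - f x0 t| <= e.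
Proof.
move=> /subspace_continuousP cf /compact_near_coveringP/near_covering_withinP cK KI Ux0 e0.
have := cK X (within U (nbhs x0)) (fun x t => `|f x t - f x0 t| <= e) _.
apply => t Kt.
have e20 : 0 < e / 2 by lra.
have := cf (x0, t) (conj Ux0 (KI _ Kt)).
move=> /cvgrPdist_le /(_ _ e20) [[P Q] /= [Px0 Qt] PQ].
have h1 x s : P x -> U x -> Q s -> K s -> `|f x0 t - f x s| <= e / 2.
  by move=> Px Ux Qs Ks; apply: (PQ (x, s)) => //; split => //; exact: KI.
exists (Q, fun x => U x /\ P x) => /=.
  by split=> //; apply: filterS Px0.
move=> [s x] /= [Qs [Ux Px]] Ks.
have h2 := h1 x s Px Ux Qs Ks.
have h3 := h1 x0 s (nbhs_singleton Px0) Ux0 Qs Ks.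
have -> : f x s - f x0 s = (f x0 t - f x0 s) - (f x0 t - f x s) by lra.
by rewrite (le_trans (ler_normB _ _))//; lra.
Qed.

End OneSidedDerivatives.

(** * Linear equations with a continuous parameter *)

Section ParametricODE.
Context {R : realType}.
Implicit Types (s t a b c df : R) (I : set R).

(* Freezing the coefficients of an equation outside [[a, b]] makes them bounded and
   defined on the whole line. *)
Definition clamp a b t := Num.max a (Num.min b t).

Lemma clamp_id a b t : a <= t <= b -> clamp a b t = t.
Proof. by move=> /andP[at_ tb]; rewrite /clamp (min_idPr tb) (max_idPr at_). Qed.

Lemma clamp_itv a b t : a <= b -> a <= clamp a b t <= b.
Proof. by move=> ab; rewrite /clamp le_max lexx ge_max ab ge_min lexx. Qed.

Lemma clamp_continuous a b : continuous (clamp a b).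
Proof.
move=> t; apply: continuous_max; first exact: cvg_cst.
by apply: continuous_min; [exact: cvg_cst|exact: cvg_id].
Qed.

Lemma segment_bounded (f : R -> R) a b : continuous f ->
  exists M, forall t, a <= t <= b -> `|f t| <= M.
Proof.
move=> cf; have [ab|ba] := leP a b; last first.
  by exists 0 => t /andP[at_ tb]; have := lt_le_trans ba (le_trans at_ tb); rewrite ltxx.
have [|c _ fc] := @EVT_max R (fun t => `|f t|) a b ab.
  apply: continuous_subspaceT => t.
  exact: (continuous_comp (cf t) (@norm_continuous _ _ _)).
by exists `|f c| => t tab; apply: fc; rewrite in_itv.
Qed.

Lemma segment_sub I a b : is_interval I -> I a -> I b -> `[a, b] `<=` I.
Proof.
by move=> itvI Ia Ib t /=; rewrite in_itv/=; exact: (itvI _ _ Ia Ib).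
Qed.

Section CoefficientFamilies.
Variables (X : topologicalType) (U : set X) (I : set R) (K : finType).
Variables (B : K -> K -> X -> R -> R) (y0 : K -> R).
Hypotheses (itvI : is_interval I) (I0 : I 0).
Hypothesis B_cont : forall i j,
  {within U `*` I, continuous (fun p : X * R => B i j p.1 p.2)}.

Let slice_cont x a b i j : U x -> I a -> I b -> a <= b ->
  continuous (fun t => B i j x (clamp a b t)).
Proof.
move=> Ux Ia Ib ab t.
have /subspace_continuousP/(_ (x, clamp a b t)) := @B_cont i j.
have Ic s : I (clamp a b s).
  by apply: (segment_sub itvI Ia Ib); rewrite /= in_itv/=; exact: clamp_itv.
move=> /(_ (conj Ux (Ic t))) /cvgrPdist_le H.
apply/cvgrPdist_le => e e0; have [[P Q] /= [Px Qt] PQ] := H e e0.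
have nQ : nbhs t (clamp a b @^-1` Q) by exact: (clamp_continuous Qt).
apply: filterS nQ => s Qs.
exact: (PQ (x, clamp a b s) (conj (nbhs_singleton Px) Qs) (conj Ux (Ic s))).
Qed.

Let slice_bound x a b : U x -> I a -> I b -> a <= b ->
  exists2 M, 0 <= M & forall i j t, `|B i j x (clamp a b t)| <= M.
Proof.
move=> Ux Ia Ib ab.
have /choice[M MP] : forall ij : K * K, exists M, forall t,
    `|B ij.1 ij.2 x (clamp a b t)| <= M.
  move=> [i j] /=; have [M MP] := segment_bounded a b (@slice_cont x a b i j Ux Ia Ib ab).
  exists M => t; have := MP _ (clamp_itv t ab).
  by rewrite clamp_id// clamp_itv.
have M0 ij : 0 <= M ij by apply: le_trans (MP ij 0).
exists (\sum_ij M ij) => [|i j t]; first exact: sumr_ge0.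
by apply: (le_trans (MP (i, j) t)); rewrite (bigD1 (i, j))//= lerDl sumr_ge0.
Qed.

Let sol x a b (y : K -> R -> R) := (forall i, y i 0 = y0 i) /\
  forall i t, is_derive t 1 (y i) (\sum_j B i j x (clamp a b t) * y j t).

Let exists_sol x a b : U x -> I a -> I b -> a <= b -> exists y, sol x a b y.
Proof.
move=> Ux Ia Ib ab; have [M M0 MP] := slice_bound Ux Ia Ib ab.
have [|y y_0 dy] := @linear_ode_bounded _ K (fun i j t => B i j x (clamp a b t)) M y0 _ MP.
  by move=> i j; exact: slice_cont.
by exists y.
Qed.

(** On the intersection of the two segments neither clamp acts, so the difference solves a
    homogeneous equation with initial value 0; Gronwall's inequality with [d = 0] forces it to
    vanish. *)
Let sol_unique x a1 b1 a2 b2 y z : U x -> I a1 -> I b1 -> I a2 -> I b2 ->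
  a1 <= 0 <= b1 -> a2 <= 0 <= b2 -> sol x a1 b1 y -> sol x a2 b2 z ->
  forall i t, a1 <= t <= b1 -> a2 <= t <= b2 -> y i t = z i t.
Proof.
move=> Ux Ia1 Ib1 Ia2 Ib2 /andP[a10 b10] /andP[a20 b20] [yi dy] [zi dz] i t t1 t2.
have [M M0 MP] := slice_bound Ux Ia1 Ib1 (le_trans a10 b10).
pose a := Num.max a1 a2; pose b := Num.min b1 b2.
have a0b : a <= 0 <= b by rewrite /a /b ge_max le_min a10 a20 b10 b20.
have tab : a <= t <= b.
  by rewrite /a /b ge_max le_min; case/andP: t1 => -> ->; case/andP: t2 => -> ->.
have := @gronwall R K (fun i t => y i t - z i t)
  (fun i t => \sum_j B i j x (clamp a1 b1 t) * y j t - \sum_j B i j x (clamp a2 b2 t) * z j t)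
  M 0 a b M0 (lexx _) a0b.
move=> /(_ _ _ _ i t tab); rewrite expr0n/= mul0r => H.
apply/eqP; rewrite -subr_eq0 -sqrf_eq0 eq_le sqr_ge0 andbT; apply: H => {t t1 t2 tab i}.
- by move=> i; rewrite yi zi subrr.
move=> i t; rewrite /a /b ge_max le_min => /andP[/andP[h1 h2] /andP[h3 h4]].
rewrite !clamp_id ?h1 ?h2 ?h3 ?h4// addr0 -sumrB.
apply: (le_trans (ler_norm_sum _ _ _)); rewrite mulr_sumr; apply: ler_sum => j _.
rewrite -mulrBr normrM ler_wpM2r//.
by have := MP i j t; rewrite clamp_id ?h1 ?h3.
Qed.

(** The value at [t] is read from the solution on the segment between 0 and [t]. By uniqueness it
    agrees with the solution on any segment of [I] containing 0 and [t], so the local properties at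
    [t] may be checked on one fixed larger segment. *)
Lemma linear_ode_param : exists y : K -> X -> R -> R,
  [/\ forall i x, U x -> y i x 0 = y0 i,
      forall i x t, U x -> I t ->
        has_real_deriv_in I (y i x) t (\sum_j B i j x t * y j x t) &
      forall i, {within U `*` I, continuous (fun p : X * R => y i p.1 p.2)}].
Proof.
have /choice[Y YP] : forall xab : X * R * R, exists y,
    U xab.1.1 -> I xab.1.2 -> I xab.2 -> xab.1.2 <= xab.2 -> sol xab.1.1 xab.1.2 xab.2 y.
  move=> [[x a] b] /=; have [[Ux [Ia [Ib ab]]]|nex] := pselect (U x /\ I a /\ I b /\ a <= b).
    by have [y yP] := exists_sol Ux Ia Ib ab; exists y.
  by exists (fun _ _ => 0) => Ux Ia Ib ab; case: nex.
pose y i x t := Y (x, Num.min 0 t, Num.max 0 t) i t.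
have yE x a b i t : U x -> I a -> I b -> a <= 0 <= b -> a <= t <= b ->
    y i x t = Y (x, a, b) i t.
  move=> Ux Ia Ib a0b tab; have /andP[a0 b0] := a0b.
  have It : I t by apply: (segment_sub itvI Ia Ib); rewrite /= in_itv.
  have Imin : I (Num.min 0 t) by rewrite minEle; case: ifP.
  have Imax : I (Num.max 0 t) by rewrite maxEle; case: ifP.
  have min0max : Num.min 0 t <= 0 <= Num.max 0 t by rewrite ge_min le_max lexx.
  have mintmax : Num.min 0 t <= t <= Num.max 0 t by rewrite ge_min le_max lexx !orbT.
  apply: (sol_unique Ux Imin Imax Ia Ib) => //.
    by apply: YP => //=; case/andP: min0max => /le_trans; apply.
  by apply: YP => //=; apply: le_trans b0.
exists y; split.
- move=> i x Ux; rewrite (yE x 0 0) ?lexx//.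
  by have [-> _] : sol x 0 0 (Y (x, 0, 0)) by apply: YP => /=.
- move=> i x t Ux It.
  have [a [b [Ia Ib a0b tab nab]]] := interval_core itvI I0 It.
  have ab : a <= b by case/andP: a0b; exact: le_trans.
  have [_ dY] : sol x a b (Y (x, a, b)) by apply: YP.
  have := is_derive_has_real_deriv_in I (dY i t); rewrite clamp_id//.
  under eq_bigr => j _ do rewrite -yE//.
  apply: eq_has_real_deriv_in; first by rewrite -yE.
  by apply: filterS nab => s + Is => /(_ Is) sab; rewrite -yE.
move=> i; apply/subspace_continuousP => -[x0 t0] [/= Ux0 It0].
have [a [b [Ia Ib a0b tab nab]]] := interval_core itvI I0 It0.
have ab : a <= b by case/andP: a0b; exact: le_trans.
have solY x : U x -> sol x a b (Y (x, a, b)) by move=> Ux; apply: YP.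
have Yc x j : U x -> continuous (Y (x, a, b) j).
  move=> Ux t; apply: differentiable_continuous; apply/derivable1_diffP.
  by apply: ex_derive; exact: (solY x Ux).2.
have [M M0 MP] := slice_bound Ux0 Ia Ib ab.
have [D DP] : exists D, forall t, a <= t <= b -> \sum_j `|Y (x0, a, b) j t| <= D.
  have [|D DP] := @segment_bounded (fun t => \sum_j `|Y (x0, a, b) j t|) a b.
    move=> t; apply: (cvg_big add_continuous) => j _.
    exact: (continuous_comp (Yc x0 j Ux0 t) (@norm_continuous _ _ _)).
  by exists D => t /DP; apply: le_trans; exact: ler_norm.
have D0 : 0 <= D by apply: le_trans (DP t0 tab); exact: sumr_ge0.
(* The Gronwall factor plus 1. Gronwall bounds the square of the difference by
   [(d * D)^2 * (C - 1)], and [C - 1 <= C^2] then gives the bound [d * D * C] without a square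
   root. *)
pose C := #|K|%:R * expR ((2 * #|K|%:R * (M + 1) + 1) * (b - a)) + 1.
have C1 : 1 <= C by rewrite /C lerDr mulr_ge0// expR_ge0.
have near_sol e : 0 < e -> \forall x \near x0, U x ->
    forall t, a <= t <= b -> `|Y (x, a, b) i t - Y (x0, a, b) i t| <= e.
  move=> e0.
  (* The tolerance for the coefficients: [d <= 1] keeps them below [M + 1] at the nearby point [x],
     the quotient ensures [d * D * C <= e], and its denominator is positive even if [D = 0]. *)
  pose d := Num.min 1 (e / (D * C + 1)).
  have DC : 0 <= D * C by rewrite mulr_ge0//; lra.
  have d0 : 0 < d by rewrite /d lt_min ltr01 divr_gt0//; lra.
  have dDC : d * D * C <= e.
    have : d <= e / (D * C + 1) by rewrite /d ge_min lexx orbT.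
    by rewrite ler_pdivlMr; nra.
  have nB : \forall x \near x0, forall ij : K * K, U x -> forall t, `[a, b]%classic t ->
      `|B ij.1 ij.2 x t - B ij.1 ij.2 x0 t| <= d.
    apply: filter_forall => -[k l] /=.
    by apply: (tube_cvg (@B_cont k l)) => //; [exact: segment_compact|exact: segment_sub].
  apply: filterS nB => x nB Ux.
  have {}nB k l t : a <= t <= b -> `|B k l x t - B k l x0 t| <= d.
    by move=> tab'; apply: (nB (k, l)) => //=; rewrite in_itv.
  have [Yx0 dYx] := solY x Ux; have [Yx00 dYx0] := solY x0 Ux0.
  have := @gronwall R K (fun i t => Y (x, a, b) i t - Y (x0, a, b) i t)
    (fun i t => \sum_j B i j x (clamp a b t) * Y (x, a, b) j t
      - \sum_j B i j x0 (clamp a b t) * Y (x0, a, b) j t)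
    (M + 1) (d * D) a b _ _ a0b.
  move=> H t tab'.
  have {}H : (Y (x, a, b) i t - Y (x0, a, b) i t) ^+ 2 <=
     (d * D) ^+ 2 * (#|K|%:R * expR ((2 * #|K|%:R * (M + 1) + 1) * (b - a))).
    apply: H => //.
    - by rewrite addr_ge0.
    - by rewrite mulr_ge0// ltW.
    - by move=> k; rewrite Yx0 Yx00 subrr.
    move=> k s sab; rewrite !clamp_id// -sumrB.
    (* With [B y - B0 y0 = B (y - y0) + (B - B0) y0], the change of coefficients becomes an
       inhomogeneous term of size at most [d * D]. *)
    apply: (@le_trans _ _ (\sum_j ((M + 1) * `|Y (x, a, b) j s - Y (x0, a, b) j s|
        + d * `|Y (x0, a, b) j s|))).
      apply: (le_trans (ler_norm_sum _ _ _)); apply: ler_sum => j _.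
      have -> : B k j x s * Y (x, a, b) j s - B k j x0 s * Y (x0, a, b) j s =
        B k j x s * (Y (x, a, b) j s - Y (x0, a, b) j s)
        + (B k j x s - B k j x0 s) * Y (x0, a, b) j s by ring.
      apply: (le_trans (ler_normD _ _)); rewrite !normrM; apply: lerD.
        rewrite ler_wpM2r//.
        have -> : B k j x s = B k j x0 s + (B k j x s - B k j x0 s) by ring.
        apply: (le_trans (ler_normD _ _)); apply: lerD.
          by have := MP k j s; rewrite clamp_id.
        by apply: (le_trans (nB k j s sab)); rewrite /d ge_min lexx.
      by rewrite ler_wpM2r// nB.
    by rewrite big_split/= -!mulr_sumr lerD2l; apply: ler_wpM2l; [exact: ltW|exact: DP].
  apply: le_trans dDC; rewrite -(@ler_pXn2r _ 2)// ?nnegrE ?mulr_ge0//; try lra.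
  rewrite -normrX ger0_norm ?sqr_ge0// (le_trans H)// [leRHS]exprMn ler_wpM2l ?sqr_ge0//.
  by rewrite -/C expr2; move: C1; rewrite /C; nra.
apply/cvgrPdist_le => e e0.
have e20 : 0 < e / 2 by lra.
have /cvgrPdist_le/(_ _ e20) nt := Yc x0 i Ux0 t0.
have := near_sol _ e20 => nx.
rewrite near_withinE.
exists ([set x | U x -> forall t, a <= t <= b ->
    `|Y (x, a, b) i t - Y (x0, a, b) i t| <= e / 2],
  [set t | (I t -> a <= t <= b) /\ `|Y (x0, a, b) i t0 - Y (x0, a, b) i t| <= e / 2]).
  by split=> //=; apply: filterI.
move=> [x t] /= [hx [tab' ht]] [/= Ux It]; have {}tab' := tab' It.
rewrite -[X in `|X|]/(y i x0 t0 - y i x t) !(yE _ a b)//.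
have := hx Ux t tab'; move: ht; rewrite !ler_norml; lra.
Qed.

End CoefficientFamilies.
End ParametricODE.

(** * Complex-valued families of class C^k *)

Section ComplexLimits.
Context {R : realType}.
Local Notation C := R[i].
Local Notation Re := (@complex.Re R).
Local Notation Im := (@complex.Im R).

Lemma Num_conjE (z : C) : Num.conj z = conjc z.
Proof. by []. Qed.

Lemma normc_ge_Im (z : C) : (`|Im z|%:C <= `|z|)%C.
Proof.
by rewrite normc_def lecR -sqrtr_sqr ler_wsqrtr// lerDr sqr_ge0.
Qed.

Lemma normc_le_ReIm (z : C) : (`|z| <= (`|Re z| + `|Im z|)%:C)%C.
Proof.
rewrite normc_def lecR -[leRHS]ger0_norm ?addr_ge0// -sqrtr_sqr ler_wsqrtr//.
rewrite sqrrD !real_normK ?num_real// lerD2r lerDl mulrn_wge0// mulr_ge0//.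
Qed.

Lemma cvg_complexP (T : Type) (F : set_system T) (FF : Filter F) (f : T -> C) (a : C) :
  (f @ F --> a) <->
  ((fun x => Re (f x)) @ F --> Re a /\ (fun x => Im (f x)) @ F --> Im a).
Proof.
split=> [fa|[fR fI]].
  have {}fa (e : C) : 0 < e -> \forall x \near F, `|a - f x| <= e.
    by move=> e0; exact: ((@cvgrPdist_le C C^o _ F FF f a).1 fa e e0).
  have {}fa (e : R) : 0 < e -> \forall x \near F, `|a - f x| <= (e%:C)%C.
    by move=> e0; apply: fa; rewrite ltcR.
  split; apply/cvgrPdist_le => e /fa; apply: filterS => x h; rewrite -lecR; apply: le_trans h.
    by rewrite -raddfB; exact: normc_ge_Re.
  by rewrite -raddfB; exact: normc_ge_Im.
apply: ((@cvgrPdist_le C C^o _ F FF f a).2 _) => e e0.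
(* In the partial order of the complex numbers a positive element is real. *)
have eE : e = ((Re e)%:C)%C by rewrite RRe_real// gtr0_real.
have e2 : 0 < Re e / 2 by rewrite divr_gt0// -ltcR -eE.
have /cvgrPdist_le/(_ _ e2) nR := fR; have /cvgrPdist_le/(_ _ e2) nI := fI.
apply: filterS2 nR nI => x hR hI; apply: (le_trans (normc_le_ReIm _)).
by rewrite eE lecR !raddfB; lra.
Qed.


Lemma within_continuous_complexP (X : topologicalType) (A : set X) (f : X -> C) :
  {within A, continuous f} <->
  {within A, continuous (fun x => Re (f x))} /\ {within A, continuous (fun x => Im (f x))}.
Proof.
rewrite !subspace_continuousP; split=> [cf|[cR cI] x Ax].
  by split=> x /cf /cvg_complexP[].
by apply/cvg_complexP; split; [exact: cR|exact: cI].
Qed.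

Lemma conj_realMB (q : R) (z w : C) :
  Num.conj ((q%:C)%C * (z - w)) = (q%:C)%C * (Num.conj z - Num.conj w).
Proof.
rewrite !Num_conjE; case: z w => [a b] [c d]; apply/eqP; rewrite eq_complex /=.
by apply/andP; split; apply/eqP; ring.
Qed.

Section Filters.
Variables (T : Type) (F : set_system T).
Context {FF : Filter F}.
Implicit Types (f g : T -> C) (a b : C).

Lemma cvg_complexD f g a b : f @ F --> a -> g @ F --> b -> (fun x => f x + g x) @ F --> a + b.
Proof. by move=> h k; apply: (@cvgD _ C^o _ _ _ f g a b h k). Qed.

Lemma cvg_complex_cst a : (fun _ : T => a) @ F --> a.
Proof. exact: (@cvg_cst C^o a T F FF). Qed.

Lemma cvg_complexM f g a b : f @ F --> a -> g @ F --> b -> (fun x => f x * g x) @ F --> a * b.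
Proof. by move=> h k; exact: (@cvgM C T F FF f g a b h k). Qed.

Lemma cvg_complexV f a : a != 0 -> f @ F --> a -> (fun x => (f x)^-1) @ F --> a^-1.
Proof. by move=> a0 h; exact: (cvgV a0 h). Qed.

Lemma cvg_complex_conj f a : f @ F --> a -> (fun x => Num.conj (f x)) @ F --> Num.conj a.
Proof.
move=> /cvg_complexP[hR hI]; apply/cvg_complexP; split.
  rewrite (_ : Re (Num.conj a) = Re a); last by case: (a).
  rewrite (_ : (fun x => Re (Num.conj (f x))) = fun x => Re (f x))//.
  by apply/funext => x; case: (f x).
rewrite (_ : Im (Num.conj a) = - Im a); last by case: (a).
rewrite (_ : (fun x => Im (Num.conj (f x))) = fun x => - Im (f x)); last first.
  by apply/funext => x; case: (f x).
exact: cvgN.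
Qed.

End Filters.

Lemma cvg_complex_unique (T : Type) (F : set_system T) (FF : ProperFilter F)
    (f : T -> C) (a b : C) :
  f @ F --> a -> f @ F --> b -> a = b.
Proof.
move=> h1 h2.
exact: (@cvg_unique C^o (@norm_hausdorff _ C^o) (f @ F) _ a b h1 h2).
Qed.

Section Derivatives.
Variable I : set R.
Implicit Types (s t : R) (f g : R -> C) (a b df dg : C).
Local Notation quot t := (fun s : R => (((s - t)^-1)%:C)%C).

#[local] Instance within_dnbhs_filter t : Filter (within I t^').
Proof. exact: within_filter. Qed.

Lemma has_deriv_in_complexP f t df : has_deriv_in I f t df <->
  has_real_deriv_in I (fun s => Re (f s)) t (Re df) /\
  has_real_deriv_in I (fun s => Im (f s)) t (Im df).
Proof.
rewrite /has_deriv_in cvg_complexP /has_real_deriv_in.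
have -> : (fun s => Re ((((s - t)^-1)%:C)%C * (f s - f t))) =
    fun s => (s - t)^-1 * (Re (f s) - Re (f t)).
  by apply/funext => s; case: (f s) (f t) => [x y] [x' y'] /=; rewrite mul0r subr0.
have -> : (fun s => Im ((((s - t)^-1)%:C)%C * (f s - f t))) =
    fun s => (s - t)^-1 * (Im (f s) - Im (f t)).
  by apply/funext => s; case: (f s) (f t) => [x y] [x' y'] /=; rewrite mul0r addr0.
by [].
Qed.

Lemma has_deriv_in_cvg f t df : has_deriv_in I f t df ->
  f s @[s --> within I t^'] --> f t.
Proof.
move=> dF.
have h1 : (fun s => ((s - t)%:C)%C) @ within I t^' --> (0 : C).
  apply/cvg_complexP; split; last exact: cvg_cst.
  rewrite /= -(subrr t); apply: cvgB; last exact: cvg_cst.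
  apply: cvg_trans; last exact: (@cvg_id _ (nbhs t)).
  by move=> P nP; rewrite /within/=; apply: filterS nP => s Ps _ _.
have : (fun s => ((s - t)%:C)%C * ((((s - t)^-1)%:C)%C * (f s - f t)) + f t)
    @ within I t^' --> 0 * df + f t.
  exact: (cvg_complexD (cvg_complexM h1 dF) (@cvg_complex_cst _ _ _ (f t))).
rewrite mul0r add0r; apply: cvg_trans; apply: near_eq_cvg.
rewrite !near_withinE; near=> s => st _.
rewrite mulrA -rmorphM mulfV ?subr_eq0//.
by rewrite rmorph1 mul1r subrK.
Unshelve. all: by end_near. Qed.

Lemma has_deriv_in_ext f g t df : I t -> (forall s, I s -> f s = g s) ->
  has_deriv_in I f t df -> has_deriv_in I g t df.
Proof.
move=> It fg; apply: cvg_trans; apply: near_eq_cvg.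
rewrite !near_withinE; near=> s => _ Is.
by rewrite /= !fg.
Unshelve. all: by end_near. Qed.

Lemma has_deriv_in_cst a t : has_deriv_in I (fun _ => a) t 0.
Proof.
rewrite /has_deriv_in; under eq_fun do rewrite subrr mulr0.
exact: cvg_complex_cst.
Qed.

Lemma has_deriv_inD f g t df dg : has_deriv_in I f t df -> has_deriv_in I g t dg ->
  has_deriv_in I (fun s => f s + g s) t (df + dg).
Proof.
move=> dF dG; rewrite /has_deriv_in.
under eq_fun do rewrite opprD addrACA mulrDr.
exact: (cvg_complexD dF dG).
Qed.

Lemma has_deriv_inM f g t df dg : has_deriv_in I f t df -> has_deriv_in I g t dg ->
  has_deriv_in I (fun s => f s * g s) t (df * g t + f t * dg).
Proof.
move=> dF dG; rewrite /has_deriv_in.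
have e s : (((s - t)^-1)%:C)%C * (f s * g s - f t * g t) =
   (((s - t)^-1)%:C)%C * (f s - f t) * g s + f t * ((((s - t)^-1)%:C)%C * (g s - g t)) by ring.
under eq_fun do rewrite e.
exact: (cvg_complexD (cvg_complexM dF (has_deriv_in_cvg dG))
  (cvg_complexM (@cvg_complex_cst _ _ _ (f t)) dG)).
Qed.

Lemma has_deriv_inV f t df : f t != 0 -> has_deriv_in I f t df ->
  has_deriv_in I (fun s => (f s)^-1) t (- df * ((f t)^-1 * (f t)^-1)).
Proof.
move=> ft0 dF; rewrite /has_deriv_in.
have cf := has_deriv_in_cvg dF.
have : (fun s => -1 * ((((s - t)^-1)%:C)%C * (f s - f t)) * ((f s)^-1 * (f t)^-1))
    @ within I t^' --> -1 * df * ((f t)^-1 * (f t)^-1).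
  exact: (cvg_complexM (cvg_complexM (@cvg_complex_cst _ _ _ (-1)) dF)
    (cvg_complexM (cvg_complexV ft0 cf) (@cvg_complex_cst _ _ _ (f t)^-1))).
rewrite mulN1r; apply: cvg_trans; apply: near_eq_cvg.
have n0 : \forall s \near within I t^', f s != 0.
  have /(@cvgrPdist_lt C C^o _ _ _ f (f t)) H := cf.
  have := H `|f t|; rewrite normr_gt0 => /(_ ft0).
  apply: filterS => s; apply: contraTneq => ->.
  by rewrite subr0 ltxx.
apply: filterS n0 => s fs0 /=; move: (((s - t)^-1)%:C)%C => q; field.
by rewrite fs0 ft0.
Qed.

Lemma has_deriv_in_conj f t df : has_deriv_in I f t df ->
  has_deriv_in I (fun s => Num.conj (f s)) t (Num.conj df).
Proof.
move=> dF; rewrite /has_deriv_in.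
rewrite [X in X @ _](_ : _ = fun s => Num.conj ((((s - t)^-1)%:C)%C * (f s - f t))).
  exact: (cvg_complex_conj dF).
by apply/funext => s; rewrite conj_realMB.
Qed.

Lemma has_deriv_in_sum (J : Type) (r : seq J) (P : pred J) (f : J -> R -> C) (df : J -> C) t :
  (forall j, P j -> has_deriv_in I (f j) t (df j)) ->
  has_deriv_in I (fun s => \sum_(j <- r | P j) f j s) t (\sum_(j <- r | P j) df j).
Proof.
move=> dF; elim: r => [|j r ih].
  by rewrite big_nil; under eq_fun do rewrite big_nil; exact: has_deriv_in_cst.
rewrite big_cons; under eq_fun do rewrite big_cons.
by case: ifPn => Pj; [exact: (has_deriv_inD (dF _ Pj) ih)|exact: ih].
Qed.

End Derivatives.
End ComplexLimits.

(** * Uniqueness and vanishing of derivatives on an interval around 0 *)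

Section Intervals.
Context {R : realType}.
Variable I : set R.
Hypotheses (itvI : is_interval I) (nI : nbhs 0 I).
Implicit Types (s t : R).

(** Since 0 is interior, [I] has a point [c] other than [t], and convexity supplies points
    [t + k * (c - t)] of [I] arbitrarily close to [t]. This makes derivatives relative to [I]
    unique, at endpoints too. *)
Lemma within_dnbhs_proper t : I t -> ProperFilter (within I t^').
Proof.
move=> It.
have [c Ic ct] : exists2 c, I c & c != t.
  have [t0|t0] := eqVneq t 0; last by exists 0; [exact: nbhs_singleton nI|rewrite eq_sym].
  have /nbhs_ballP[e /= e0 eI] := nI; exists (e / 2).
    by apply: eI; rewrite /ball/= sub0r normrN gtr0_norm; lra.
  by rewrite t0; apply/eqP; lra.
apply: Build_ProperFilter => /nbhs_ballP[d /= d0 H].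
have ct0 : 0 < `|c - t| by rewrite normr_gt0 subr_eq0.
pose k := Num.min 1 (d / (2 * `|c - t|)).
have k0 : 0 < k by rewrite /k lt_min ltr01 divr_gt0// mulr_gt0.
have k1 : k <= 1 by rewrite /k ge_min lexx.
apply: (H (t + k * (c - t))).
- rewrite /ball/= opprD addrA subrr sub0r normrN normrM (gtr0_norm k0).
  have : k <= d / (2 * `|c - t|) by rewrite /k ge_min lexx orbT.
  by rewrite ler_pdivlMr; nra.
- by rewrite -subr_eq0 addrAC subrr add0r mulf_neq0 ?subr_eq0// gt_eqF.
- have [tc|ct'] := leP t c.
    by apply: (itvI It Ic); nra.
  by apply: (itvI Ic It); nra.
Qed.

Lemma has_deriv_in_unique (f : R -> R[i]) t df df' : I t ->
  has_deriv_in I f t df -> has_deriv_in I f t df' -> df = df'.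
Proof. by move=> It; apply: cvg_complex_unique; exact: within_dnbhs_proper. Qed.

Lemma has_real_deriv_in_is_derive (f : R -> R) t df :
  nbhs t I -> has_real_deriv_in I f t df -> is_derive t 1 f df.
Proof.
move=> It dF.
have h : h^-1 *: (f (h *: 1 + t) - f t) @[h --> 0^'] --> df.
  apply/cvgrPdist_le => e e0; move/cvgrPdist_le : dF => /(_ e e0) /nbhs_ballP[d /= d0 H].
  have /nbhs_ballP[d' /= d'0 H'] := It.
  apply/nbhs_ballP; exists (Num.min d d'); first by rewrite /= lt_min d0.
  move=> k /=; rewrite /ball/= sub0r normrN lt_min => /andP[kd kd'] k0.
  have := H (k + t); rewrite /ball/= opprD addrCA subrr addr0 normrN => /(_ kd).
  rewrite addrK /GRing.scale/= mulr1; apply.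
    by rewrite -subr_eq0 addrK.
  by apply: H'; rewrite /ball/= opprD addrCA subrr addr0 normrN.
apply: DeriveDef; first by apply/cvg_ex; exists df.
exact: cvg_lim h.
Qed.

Lemma has_real_deriv_in_continuous (f : R -> R) t df :
  has_real_deriv_in I f t df -> f s @[s --> within I (nbhs t)] --> f t.
Proof.
move=> dF.
have : (fun s => (s - t) * ((s - t)^-1 * (f s - f t)) + f t) @ within I t^' --> 0 * df + f t.
  apply: cvgD; last exact: cvg_cst.
  apply: cvgM => //; rewrite -(subrr t); apply: cvgB; last exact: cvg_cst.
  apply: cvg_trans; last exact: (@cvg_id _ (nbhs t)).
  by move=> P nP; rewrite /within/=; apply: filterS nP => s Ps _ _.
rewrite mul0r add0r => /cvgrPdist_le H; apply/cvgrPdist_le => e e0.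
have := H e e0; rewrite !near_withinE; apply: filterS => s /= Hs Is.
have [->|st] := eqVneq s t; first by rewrite subrr normr0 ltW.
by have := Hs st Is; rewrite mulrA mulfV ?subr_eq0// mul1r subrK.
Qed.

(** The mean value theorem asks for two-sided derivatives only inside the segment, where a
    derivative relative to [I] is one; at the ends continuity suffices, and the relative derivative
    provides it. *)
Lemma has_real_deriv_in0_cst (f : R -> R) :
  (forall t, I t -> has_real_deriv_in I f t 0) ->
  forall s t, I s -> I t -> f s = f t.
Proof.
move=> dF; suff H s t : I s -> I t -> s <= t -> f s = f t.
  by move=> s t Is It; have [/H|/ltW/H h] := leP s t; [exact|apply/esym; exact: h].
move=> Is It st.
have sub x : s <= x <= t -> I x by exact: itvI.
have [x xst||c _] := @MVT_segment R f (fun=> 0) s t st.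
- apply: has_real_deriv_in_is_derive.
    apply: filterS (near_in_itvoo xst) => y; rewrite in_itv/= => /andP[sy yt].
    by apply: sub; rewrite !ltW.
  by apply: dF; apply: sub; move: xst; rewrite in_itv/= => /andP[sy yt]; rewrite !ltW.
- apply/subspace_continuousP => x /=; rewrite in_itv/= => xst.
  apply: cvg_trans (has_real_deriv_in_continuous (dF x (sub x xst))).
  apply: cvg_app; apply: within_subset => y /=; rewrite in_itv/=.
  exact: sub.
by rewrite mul0r => /eqP; rewrite subr_eq0 => /eqP.
Qed.

Lemma has_deriv_in0_cst (f : R -> R[i]) :
  (forall t, I t -> has_deriv_in I f t 0) ->
  forall s t, I s -> I t -> f s = f t.
Proof.
move=> dF s t Is It; apply/eqP; rewrite eq_complex; apply/andP; split; apply/eqP.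
  apply: (@has_real_deriv_in0_cst (fun t => complex.Re (f t)) _ s t Is It) => x Ix.
  by have [] := (has_deriv_in_complexP I f x 0).1 (dF x Ix).
apply: (@has_real_deriv_in0_cst (fun t => complex.Im (f t)) _ s t Is It) => x Ix.
by have [] := (has_deriv_in_complexP I f x 0).1 (dF x Ix).
Qed.

End Intervals.

Section WithinContinuous.
Context {R : realType}.
Variables (Y : topologicalType) (A : set Y).
Implicit Types (f g : Y -> R[i]).

Lemma within_continuous_complexD f g : {within A, continuous f} -> {within A, continuous g} ->
  {within A, continuous (fun y => f y + g y)}.
Proof.
move=> /subspace_continuousP cf /subspace_continuousP cg; apply/subspace_continuousP => y Ay.
exact: (@cvg_complexD R Y (within A (nbhs y)) _ f g _ _ (cf y Ay) (cg y Ay)).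
Qed.

Lemma within_continuous_complexM f g : {within A, continuous f} -> {within A, continuous g} ->
  {within A, continuous (fun y => f y * g y)}.
Proof.
move=> /subspace_continuousP cf /subspace_continuousP cg; apply/subspace_continuousP => y Ay.
exact: (@cvg_complexM R Y (within A (nbhs y)) _ f g _ _ (cf y Ay) (cg y Ay)).
Qed.

Lemma within_continuous_complexV f : (forall y, A y -> f y != 0) ->
  {within A, continuous f} -> {within A, continuous (fun y => (f y)^-1)}.
Proof.
move=> f0 /subspace_continuousP cf; apply/subspace_continuousP => y Ay.
exact: (@cvg_complexV R Y (within A (nbhs y)) _ f _ (f0 y Ay) (cf y Ay)).
Qed.

Lemma within_continuous_complex_cst (a : R[i]) : {within A, continuous (fun _ => a)}.
Proof.
apply/subspace_continuousP => y Ay.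
exact: (@cvg_complex_cst R Y (within A (nbhs y)) _ a).
Qed.

End WithinContinuous.

(** * Stability of uniformly C^k families under algebraic operations *)

Section UniformlyCk.
Context {R : realType}.
Local Notation C := R[i].
Variables (X : topologicalType) (U : set X) (I : set R).
Local Notation uCk := (uniformly_Ck U I).
Implicit Types (f g : X -> R -> C) (k : nat).

Lemma uniformly_Ck_continuous k f : uCk k f ->
  {within U `*` I, continuous (fun p : X * R => f p.1 p.2)}.
Proof. by case: k => [|k] []. Qed.

Lemma uniformly_CkW k f : uCk k.+1 f -> uCk k f.
Proof.
elim: k f => [|k ih] f /= [cf [df dF Cdf]]; first by split.
by split=> //; exists df => //; exact: ih.
Qed.

Lemma eq_within_continuous (Y Z : topologicalType) (A : set Y) (f g : Y -> Z) :
  (forall y, A y -> f y = g y) -> {within A, continuous f} -> {within A, continuous g}.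
Proof.
move=> fg; apply: subspace_eq_continuous => y; rewrite inE; exact: fg.
Qed.

Lemma eq_uniformly_Ck k f g : (forall x t, U x -> I t -> f x t = g x t) ->
  uCk k f -> uCk k g.
Proof.
move=> fg; case: k => [|k] /= [cf H]; split.
- by apply: eq_within_continuous cf => -[x t] [/= Ux It]; exact: fg.
- by [].
- by apply: eq_within_continuous cf => -[x t] [/= Ux It]; exact: fg.
have [df dF Cdf] := H; exists df => // x t Ux It.
by apply: has_deriv_in_ext (dF x t Ux It) => // s Is; exact: fg.
Qed.

Lemma uniformly_Ck_cst k (a : C) : uCk k (fun _ _ => a).
Proof.
elim: k a => [|k ih] a; split.
- exact: within_continuous_complex_cst.
- by [].
- exact: within_continuous_complex_cst.
by exists (fun _ _ => 0) => // x t _ _; exact: has_deriv_in_cst.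
Qed.

Lemma uniformly_CkD k f g : uCk k f -> uCk k g -> uCk k (fun x t => f x t + g x t).
Proof.
elim: k f g => [|k ih] f g /= [cf Hf] [cg Hg].
  by split; first exact: (within_continuous_complexD cf cg).
split; first exact: (within_continuous_complexD cf cg).
have [df dF Cdf] := Hf; have [dg dG Cdg] := Hg.
exists (fun x t => df x t + dg x t); last exact: ih.
by move=> x t Ux It; exact: (has_deriv_inD (dF x t Ux It) (dG x t Ux It)).
Qed.

Lemma uniformly_CkM k f g : uCk k f -> uCk k g -> uCk k (fun x t => f x t * g x t).
Proof.
elim: k f g => [|k ih] f g Cf Cg; have [cf Hf] := Cf; have [cg Hg] := Cg.
  by split; first exact: (within_continuous_complexM cf cg).
split; first exact: (within_continuous_complexM cf cg).
have [df dF Cdf] := Hf; have [dg dG Cdg] := Hg.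
exists (fun x t => df x t * g x t + f x t * dg x t).
  by move=> x t Ux It; exact: (has_deriv_inM (dF x t Ux It) (dG x t Ux It)).
by apply: uniformly_CkD; apply: ih => //; exact: uniformly_CkW.
Qed.

Lemma uniformly_Ck_sum k (J : Type) (r : seq J) (P : pred J) (f : J -> X -> R -> C) :
  (forall j, uCk k (f j)) -> uCk k (fun x t => \sum_(j <- r | P j) f j x t).
Proof.
move=> Cf; elim: r => [|j r ih].
  by apply: eq_uniformly_Ck (uniformly_Ck_cst k 0) => x t _ _; rewrite big_nil.
have [Pj|Pj] := boolP (P j).
  by apply: eq_uniformly_Ck (uniformly_CkD (Cf j) ih) => x t _ _; rewrite big_cons Pj.
by apply: eq_uniformly_Ck ih => x t _ _; rewrite big_cons (negbTE Pj).
Qed.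

Lemma uniformly_Ck_prod k (J : Type) (r : seq J) (P : pred J) (f : J -> X -> R -> C) :
  (forall j, uCk k (f j)) -> uCk k (fun x t => \prod_(j <- r | P j) f j x t).
Proof.
move=> Cf; elim: r => [|j r ih].
  by apply: eq_uniformly_Ck (uniformly_Ck_cst k 1) => x t _ _; rewrite big_nil.
have [Pj|Pj] := boolP (P j).
  by apply: eq_uniformly_Ck (uniformly_CkM (Cf j) ih) => x t _ _; rewrite big_cons Pj.
by apply: eq_uniformly_Ck ih => x t _ _; rewrite big_cons (negbTE Pj).
Qed.

Lemma uniformly_CkV k f : (forall x t, U x -> I t -> f x t != 0) ->
  uCk k f -> uCk k (fun x t => (f x t)^-1).
Proof.
move=> f0; have cV : {within U `*` I, continuous (fun p : X * R => f p.1 p.2 : C)} ->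
    {within U `*` I, continuous (fun p : X * R => (f p.1 p.2)^-1)}.
  by apply: within_continuous_complexV => -[x t] [/= Ux It]; exact: f0.
elim: k => [|k ih] Cf; have [cf Hf] := Cf; first by split; first exact: (cV cf).
split; first exact: (cV cf).
have [df dF Cdf] := Hf.
have CV := ih (uniformly_CkW Cf).
(* Only products and constants occur, so that the induction hypothesis for the inverse and stability
   under products suffice. *)
exists (fun x t => -1 * df x t * ((f x t)^-1 * (f x t)^-1)).
  move=> x t Ux It; rewrite mulN1r.
  exact: (has_deriv_inV (f0 x t Ux It) (dF x t Ux It)).
apply: uniformly_CkM; last exact: uniformly_CkM.
by apply: uniformly_CkM => //; exact: uniformly_Ck_cst.
Qed.

Definition uniformly_Ck_mx k (m n : nat) (A : X -> R -> 'M[C]_(m, n)) : Prop :=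
  forall i j, uCk k (fun x t => A x t i j).

Lemma uniformly_Ck_mulmx k m n p (A : X -> R -> 'M[C]_(m, n)) (B : X -> R -> 'M[C]_(n, p)) :
  uniformly_Ck_mx k A -> uniformly_Ck_mx k B -> uniformly_Ck_mx k (fun x t => A x t *m B x t).
Proof.
move=> CA CB i j.
apply: (@eq_uniformly_Ck _ (fun x t => \sum_l A x t i l * B x t l j)) => [x t _ _|].
  by rewrite mxE.
by apply: uniformly_Ck_sum => l; exact: uniformly_CkM.
Qed.

Lemma uniformly_Ck_det k n (A : X -> R -> 'M[C]_n) :
  uniformly_Ck_mx k A -> uCk k (fun x t => \det (A x t)).
Proof.
move=> CA; apply: uniformly_Ck_sum => s.
apply: uniformly_CkM; first exact: uniformly_Ck_cst.
by apply: uniformly_Ck_prod => i; exact: CA.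
Qed.

(** By the cofactor formula the entries of the inverse are polynomials in the entries of [A] divided
    by a nonvanishing determinant. *)
Lemma uniformly_Ck_invmx k n (A : X -> R -> 'M[C]_n) :
  (forall x t, U x -> I t -> A x t \in unitmx) ->
  uniformly_Ck_mx k A -> uniformly_Ck_mx k (fun x t => invmx (A x t)).
Proof.
move=> uA CA i j.
apply: (@eq_uniformly_Ck _ (fun x t => (\det (A x t))^-1 * cofactor (A x t) j i)).
  by move=> x t Ux It; rewrite /invmx uA// !mxE.
apply: uniformly_CkM.
  apply: uniformly_CkV; last exact: uniformly_Ck_det.
  by move=> x t Ux It; have := uA x t Ux It; rewrite unitmxE unitfE.
apply: uniformly_CkM; first exact: uniformly_Ck_cst.
apply: uniformly_Ck_det => a b.
by apply: eq_uniformly_Ck (CA (lift j a) (lift i b)) => x t _ _; rewrite !mxE.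
Qed.

End UniformlyCk.

(** * The matrix equation *)

Section MatrixPaths.
Context {R : realType}.
Local Notation C := R[i].
Local Notation Re := (@complex.Re R).
Local Notation Im := (@complex.Im R).

Definition adjmx m n (A : 'M[C]_(m, n)) : 'M[C]_(n, m) := (map_mx Num.conj A)^T.

Lemma adjmxE m n (A : 'M[C]_(m, n)) i j : adjmx A i j = Num.conj (A j i).
Proof. by rewrite !mxE. Qed.

Lemma adjmxK m n (A : 'M[C]_(m, n)) : adjmx (adjmx A) = A.
Proof. by apply/matrixP => i j; rewrite !adjmxE conjCK. Qed.

Lemma adjmxM m n p (A : 'M[C]_(m, n)) (B : 'M[C]_(n, p)) :
  adjmx (A *m B) = adjmx B *m adjmx A.
Proof. by rewrite /adjmx map_mxM trmx_mul. Qed.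

Lemma adjmxZ m n a (A : 'M[C]_(m, n)) : adjmx (a *: A) = Num.conj a *: adjmx A.
Proof. by apply/matrixP => i j; rewrite !(adjmxE, mxE) rmorphM. Qed.

Lemma adjmx1 n : adjmx (1%:M : 'M[C]_n) = 1%:M.
Proof. by apply/matrixP => i j; rewrite adjmxE !mxE eq_sym rmorph_nat. Qed.

Lemma adjmx_inv n (A : 'M[C]_n) : adjmx (invmx A) = invmx (adjmx A).
Proof. by rewrite /adjmx map_invmx trmx_inv. Qed.

Lemma unitmx_adj n (A : 'M[C]_n) : (adjmx A \in unitmx) = (A \in unitmx).
Proof. by rewrite /adjmx unitmx_tr map_unitmx. Qed.

Section Derivatives.
Variable I : set R.
Implicit Types s t : R.

Definition has_deriv_mx m n (A : R -> 'M[C]_(m, n)) t (dA : 'M[C]_(m, n)) : Prop :=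
  forall i j, has_deriv_in I (fun s => A s i j) t (dA i j).

Lemma has_deriv_mx_cst m n (A : 'M[C]_(m, n)) t : has_deriv_mx (fun _ => A) t 0.
Proof. by move=> i j; rewrite mxE; exact: has_deriv_in_cst. Qed.

Lemma has_deriv_mx_ext m n (A B : R -> 'M[C]_(m, n)) t dA : I t ->
  (forall s, I s -> A s = B s) -> has_deriv_mx A t dA -> has_deriv_mx B t dA.
Proof.
by move=> It AB dA' i j; apply: has_deriv_in_ext (dA' i j) => // s Is; rewrite AB.
Qed.

Lemma has_deriv_mxM m n p (A : R -> 'M[C]_(m, n)) (B : R -> 'M[C]_(n, p)) t dA dB :
  has_deriv_mx A t dA -> has_deriv_mx B t dB ->
  has_deriv_mx (fun s => A s *m B s) t (dA *m B t + A t *m dB).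
Proof.
move=> hA hB i j.
have -> : (dA *m B t + A t *m dB) i j = \sum_l (dA i l * B t l j + A t i l * dB l j).
  by rewrite !mxE big_split.
rewrite (_ : (fun s => (A s *m B s) i j) = fun s => \sum_l A s i l * B s l j).
  by apply: has_deriv_in_sum => l _; exact: (has_deriv_inM (hA i l) (hB l j)).
by apply/funext => s; rewrite mxE.
Qed.

Lemma has_deriv_mx_adj m n (A : R -> 'M[C]_(m, n)) t dA :
  has_deriv_mx A t dA -> has_deriv_mx (fun s => adjmx (A s)) t (adjmx dA).
Proof.
move=> hA i j; rewrite adjmxE.
rewrite (_ : (fun s => adjmx (A s) i j) = fun s => Num.conj (A s j i)).
  exact: (has_deriv_in_conj (hA j i)).
by apply/funext => s; rewrite adjmxE.
Qed.

End Derivatives.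

Section ComplexODE.
Variables (X : topologicalType) (U : set X) (I : set R) (r : nat).
Variables (A : X -> R -> 'M[C]_r).
Hypotheses (itvI : is_interval I) (I0 : I 0).
Hypothesis CA : uniformly_Ck_mx U I 0 A.

(* The real system for the real parts (index [false]) and the imaginary parts
   (index [true]) of the entries of a column. *)
Let B (p q : bool * 'I_r) (x : X) (t : R) : R :=
  let a := A x t p.2 q.2 in
  match p.1, q.1 with
  | false, false => Re a
  | false, true => - Im a
  | true, false => Im a
  | true, true => Re a
  end.

Lemma complex_linear_ode : exists Phi : X -> R -> 'M[C]_r,
  [/\ forall x, U x -> Phi x 0 = 1%:M,
      forall x t, U x -> I t -> has_deriv_mx I (Phi x) t (A x t *m Phi x t) &
      uniformly_Ck_mx U I 0 Phi].
Proof.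
have B_cont p q : {within U `*` I, continuous (fun z : X * R => B p q z.1 z.2)}.
  have [/within_continuous_complexP[cR cI] _] := CA p.2 q.2.
  case: p q cR cI => [[] i] [[] j] cR cI //=.
  apply/subspace_continuousP => z Az; apply: cvgN.
  by move/subspace_continuousP : cI; apply.
(* The matrix solution is built column by column: column [k] starts at the [k]-th basis vector,
   which is real. *)
pose y0 (k : 'I_r) (p : bool * 'I_r) : R := if p.1 then 0 else (p.2 == k)%:R.
have /choice[y yP] := fun k => linear_ode_param (y0 k) itvI I0 B_cont.
pose Phi x t : 'M[C]_r := \matrix_(i, k) Complex (y k (false, i) x t) (y k (true, i) x t).
exists Phi; split.
- move=> x Ux; apply/matrixP => i k; have [y_0 _ _] := yP k.
  by rewrite !mxE !y_0// /y0/=; case: eqP.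
- move=> x t Ux It i k; have [_ dy _] := yP k.
  have sumE (F : bool * 'I_r -> R) : \sum_p F p = \sum_i (F (true, i) + F (false, i)).
    rewrite (eq_bigr (fun p => F (p.1, p.2))) => [|[b j] _ //].
    by rewrite -(pair_bigA _ (fun b j => F (b, j)))/= big_bool/= big_split.
  have reE (J : finType) (z : J -> C) : Re (\sum_j z j) = \sum_j Re (z j).
    by apply: (big_morph Re) => // -[? ?] [? ?].
  have imE (J : finType) (z : J -> C) : Im (\sum_j z j) = \sum_j Im (z j).
    by apply: (big_morph Im) => // -[? ?] [? ?].
  apply/has_deriv_in_complexP; rewrite mxE; split.
    rewrite reE (_ : (fun s => Re (Phi x s i k)) = y k (false, i) x); last first.
      by apply/funext => s; rewrite mxE.
    have := dy (false, i) x t Ux It; rewrite sumE.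
    congr (has_real_deriv_in _ _ _ _); apply: eq_bigr => j _.
    by rewrite /B /= !mxE; case: (A x t i j) => a b /=; ring.
  rewrite imE (_ : (fun s => Im (Phi x s i k)) = y k (true, i) x); last first.
    by apply/funext => s; rewrite mxE.
  have := dy (true, i) x t Ux It; rewrite sumE.
  congr (has_real_deriv_in _ _ _ _); apply: eq_bigr => j _.
  by rewrite /B /= !mxE; case: (A x t i j) => a b /=; ring.
move=> i k; split; last by [].
have [_ _ cy] := yP k.
apply/within_continuous_complexP; split.
  by apply: eq_within_continuous (cy (false, i)) => z _; rewrite mxE.
by apply: eq_within_continuous (cy (true, i)) => z _; rewrite mxE.
Qed.

End ComplexODE.
End MatrixPaths.

(** * Conserved matrix, uniqueness and change of frame *)

Section MoserPath.
Context {R : realType}.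
Local Notation C := R[i].
Variables (r : nat) (I : set R).
Hypotheses (itvI : is_interval I) (nI : nbhs 0 I).
Implicit Types (W Phi Psi : R -> 'M[C]_r) (G : 'M[C]_r) (t : R).

Let I0 : I 0. Proof. exact: nbhs_singleton nI. Qed.

Lemma has_deriv_mx_unique m n (A : R -> 'M[C]_(m, n)) t dA dA' : I t ->
  has_deriv_mx I A t dA -> has_deriv_mx I A t dA' -> dA = dA'.
Proof.
move=> It h h'; apply/matrixP => i j.
exact: (has_deriv_in_unique itvI nI It (h i j) (h' i j)).
Qed.

Definition skew_unit W := forall t, I t -> adjmx (W t) = - W t /\ W t \in unitmx.

Definition moser_generator (W dW : 'M[C]_r) : 'M[C]_r := - 2^-1 *: (invmx W *m dW).

(** The derivative of [W] is quantified inside, so that this is a relation between [W] and [Phi]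
    alone; on [I] it is determined by [W], as derivatives relative to [I] are unique. *)
Definition moser_path W Phi := exists dW : R -> 'M[C]_r,
  [/\ forall t, I t -> has_deriv_mx I W t (dW t), Phi 0 = 1%:M &
      forall t, I t -> has_deriv_mx I Phi t (moser_generator (W t) (dW t) *m Phi t)].

Lemma moser_path_cst W Phi Psi t : skew_unit W -> moser_path W Phi -> moser_path W Psi ->
  I t -> adjmx (Phi t) *m W t *m Psi t = W 0.
Proof.
move=> skW [dW [hW Phi0 dPhi]] [dW' [hW' Psi0 dPsi]] It.
have dWE s : I s -> dW' s = dW s.
  by move=> Is; exact: has_deriv_mx_unique Is (hW' s Is) (hW s Is).
(* Both sides are derivatives at [s] of the same path, since [adjmx (W s) = - W s] on [I]. *)
have skdW s : I s -> adjmx (dW s) = - dW s.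
  move=> Is.
  apply: (has_deriv_mx_unique Is (has_deriv_mx_adj (hW s Is))).
  apply: (@has_deriv_mx_ext _ I _ _ (fun s => (- 1%:M) *m W s)) => // [u Iu|].
    by rewrite (skW u Iu).1 mulNmx mul1mx.
  have := has_deriv_mxM (has_deriv_mx_cst I (- 1%:M) s) (hW s Is).
  by rewrite mul0mx add0r mulNmx mul1mx.
have d0 s : I s -> has_deriv_mx I (fun s => adjmx (Phi s) *m W s *m Psi s) s 0.
  move=> Is; have [skWs uWs] := skW s Is.
  have := has_deriv_mxM (has_deriv_mxM (has_deriv_mx_adj (dPhi s Is)) (hW s Is)) (dPsi s Is).
  congr has_deriv_mx; rewrite dWE//.
  set P := adjmx (Phi s); set Q := Psi s.
  have eA : adjmx (moser_generator (W s) (dW s)) *m W s = - 2^-1 *: dW s.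
    rewrite /moser_generator adjmxZ adjmxM adjmx_inv skWs (skdW s Is) -scalemxAl.
    have -> : invmx (- W s) = - invmx (W s).
      have uN : - W s \in unitmx by rewrite -skWs unitmx_adj.
      by apply: (can_inj (mulKmx uN)); rewrite mulmxV// mulNmx mulmxN opprK mulmxV.
    rewrite mulNmx mulmxN opprK -mulmxA mulVmx// mulmx1.
    by rewrite rmorphN fmorphV rmorph_nat.
  have eB : W s *m (moser_generator (W s) (dW s) *m Q) = - 2^-1 *: (dW s *m Q).
    rewrite mulmxA /moser_generator -scalemxAr mulmxA mulmxV// mul1mx.
    by rewrite -scalemxAl.
  rewrite adjmxM -/P -(mulmxA P _ (W s)) eA -(mulmxA P (W s)) eB.
  rewrite mulmxDl -scalemxAr -scalemxAl -scalemxAr mulmxA.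
  have half : - 2^-1 - 2^-1 = - 1 :> C by field.
  by rewrite addrAC -scalerDl half scaleN1r addNr.
have e0 : adjmx (Phi 0) *m W 0 *m Psi 0 = W 0.
  by rewrite Phi0 Psi0 adjmx1 mul1mx mulmx1.
rewrite -[RHS]e0; apply/matrixP => i j.
apply: (has_deriv_in0_cst itvI (f := fun s => (adjmx (Phi s) *m W s *m Psi s) i j)) => // s Is.
by have := d0 s Is i j; rewrite mxE.
Qed.

(** A right factor of the invertible square matrix [W 0 = Phi^* W Phi] is invertible. *)
Lemma moser_path_unit W Phi t : skew_unit W -> moser_path W Phi -> I t -> Phi t \in unitmx.
Proof.
move=> skW mP It; have := moser_path_cst skW mP mP It => e.
have := (skW 0 I0).2; rewrite -e unitmx_mul => /andP[].
by [].
Qed.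

(** The invertible factor [Phi^* W] cancels in [Phi^* W Phi = W 0 = Phi^* W Psi]. *)
Lemma moser_path_unique W Phi Psi t : skew_unit W ->
  moser_path W Phi -> moser_path W Psi -> I t -> Phi t = Psi t.
Proof.
move=> skW mPhi mPsi It.
have u : adjmx (Phi t) *m W t \in unitmx.
  by rewrite unitmx_mul unitmx_adj (moser_path_unit skW mPhi It) (skW t It).2.
by apply: (can_inj (mulKmx u)); rewrite !moser_path_cst.
Qed.

(** Effect of a frame change [G] independent of [t]: the form changes by congruence, and in the
    generator [G^*] cancels, so [A] becomes [G^-1 A G] and the solution is conjugated in the same
    way. *)
Lemma moser_path_conj W Phi G : G \in unitmx -> (forall t, I t -> W t \in unitmx) ->
  moser_path W Phi ->
  moser_path (fun t => adjmx G *m W t *m G) (fun t => invmx G *m Phi t *m G).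
Proof.
move=> uG uW [dW [hW Phi0 dPhi]].
have conj_deriv (P A Q : 'M[C]_r) (M : R -> 'M[C]_r) t : has_deriv_mx I M t A ->
    has_deriv_mx I (fun t => P *m M t *m Q) t (P *m A *m Q).
  move=> hM.
  have := has_deriv_mxM (has_deriv_mxM (has_deriv_mx_cst I P t) hM) (has_deriv_mx_cst I Q t).
  by rewrite mul0mx add0r mulmx0 addr0.
exists (fun t => adjmx G *m dW t *m G); split.
- by move=> t It; exact: conj_deriv (hW t It).
- by rewrite Phi0 mulmx1 mulVmx.
move=> t It; have := conj_deriv (invmx G) _ G _ t (dPhi t It).
congr has_deriv_mx; rewrite /moser_generator.
have uGa : adjmx G \in unitmx by rewrite unitmx_adj.
have uN : adjmx G *m W t *m G \in unitmx by rewrite !unitmx_mul uGa uG uW.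
have <- : invmx G *m (invmx (W t) *m dW t) *m G =
    invmx (adjmx G *m W t *m G) *m (adjmx G *m dW t *m G).
  apply: (canRL (mulKmx uN)); rewrite !mulmxA (mulmxK uG).
  by rewrite (mulmxK (uW t It)).
by rewrite -!scalemxAl -scalemxAr -!scalemxAl !mulmxA (mulmxK uG).
Qed.

Lemma moser_path_deriv0 W Phi : moser_path W Phi -> has_deriv_mx I W 0 0 ->
  has_deriv_mx I Phi 0 0.
Proof.
move=> [dW [hW Phi0 dPhi]] W0.
have := dPhi 0 I0; rewrite (has_deriv_mx_unique I0 (hW 0 I0) W0) /moser_generator.
by rewrite mulmx0 scaler0 mul0mx.
Qed.

End MoserPath.

(** * Forms and endomorphisms of a vector bundle *)

Section LinearAlgebra.
Context {R : realType}.
Local Notation C := R[i].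

Lemma linear_comb (V W : lmodType C) (f : V -> W)
    (J : Type) (s : seq J) (a : J -> C) (v : J -> V) :
  linear f -> f (\sum_(j <- s) a j *: v j) = \sum_(j <- s) a j *: f (v j).
Proof.
move=> lf; elim: s => [|j s ih]; last by rewrite !big_cons lf ih.
rewrite !big_nil; have := lf (-1) 0 0.
by rewrite scaler0 add0r scaleN1r addNr.
Qed.

Lemma col_sum_delta n (u : 'cV[C]_n) : u = \sum_j u j 0 *: delta_mx j 0.
Proof.
rewrite [LHS]matrix_sum_delta; apply: eq_bigr => j _.
by rewrite big_ord1.
Qed.

Definition col_fun_mx m n (g : 'cV[C]_n -> 'cV[C]_m) : 'M[C]_(m, n) :=
  \matrix_(i, j) g (delta_mx j 0) i 0.

Lemma col_fun_mxE m n (g : 'cV[C]_n -> 'cV[C]_m) u : linear g -> g u = col_fun_mx g *m u.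
Proof.
move=> lg; apply/matrixP => i k; rewrite (ord1 k) [X in g X]col_sum_delta linear_comb//.
rewrite summxE [RHS]mxE; apply: eq_bigr => j _.
by rewrite !mxE mulrC.
Qed.

Section Gram.
Variables (W : lmodType C) (psi : W -> W -> C) (r : nat) (e : 'cV[C]_r -> W).
Hypotheses (psiP : hermitian_symplectic psi) (le : linear e).

Definition gram_mx : 'M[C]_r := \matrix_(i, j) psi (e (delta_mx i 0)) (e (delta_mx j 0)).

Lemma gram_mxE u v : psi (e u) (e v) = (adjmx u *m gram_mx *m v) 0 0.
Proof.
have [psil psir _ _] := psiP.
have psil_sum (J : Type) (s : seq J) (a : J -> C) (z : J -> W) w :
    psi (\sum_(j <- s) a j *: z j) w = \sum_(j <- s) Num.conj (a j) * psi (z j) w.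
  elim: s => [|j s ih]; last by rewrite !big_cons psil ih.
  rewrite !big_nil; have := psil (-1) 0 0 w.
  by rewrite scaler0 add0r rmorphN rmorph1 mulN1r addNr.
have psir_sum (J : Type) (s : seq J) (a : J -> C) (z : J -> W) w :
    psi w (\sum_(j <- s) a j *: z j) = \sum_(j <- s) a j * psi w (z j).
  elim: s => [|j s ih]; last by rewrite !big_cons psir ih.
  rewrite !big_nil; have := psir (-1) w 0 0.
  by rewrite scaler0 add0r mulN1r addNr.
have eE w : e w = \sum_j w j 0 *: e (delta_mx j 0).
  by rewrite {1}(col_sum_delta w) (linear_comb _ _ _ le).
rewrite (eE u) (eE v) psir_sum.
rewrite [RHS]mxE; apply: eq_bigr => j _.
rewrite psil_sum mulrC mxE; congr (_ * _); apply: eq_bigr => i _.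
by rewrite adjmxE mxE.
Qed.

Lemma gram_mx_skew : adjmx gram_mx = - gram_mx.
Proof.
have [_ _ psiN _] := psiP.
by apply/matrixP => i j; rewrite adjmxE !mxE [in RHS]psiN opprK.
Qed.

(** A row vector [v] in the left kernel of a singular Gram matrix would give a vector [e (adjmx v)]
    that pairs to 0 with everything; non-degeneracy and injectivity of [e] then force [v = 0]. *)
Lemma gram_mx_unit (e' : W -> 'cV[C]_r) : cancel e e' -> cancel e' e -> gram_mx \in unitmx.
Proof.
move=> ee' e'e; rewrite unitmxE unitfE; apply/negP => /det0P[v v0 vM].
have [_ _ _ nondeg] := psiP.
have : e (adjmx v) = 0.
  by apply: nondeg => w; rewrite -(e'e w) gram_mxE adjmxK vM mul0mx mxE.
have e0 : e 0 = 0.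
  by have := le (-1) 0 0; rewrite scaler0 add0r scaleN1r addNr.
rewrite -e0 => /(can_inj ee') v00.
move/eqP: v0; apply; rewrite -[v]adjmxK v00.
by apply/matrixP => i j; rewrite adjmxE !mxE rmorph0.
Qed.

End Gram.
End LinearAlgebra.

(** * Transition matrices between trivializations *)

Section Trivializations.
Context {R : realType}.
Local Notation C := R[i].
Variables (X : topologicalType) (r : nat) (V : complexVectorBundle R X r).
Implicit Types T : trivialization V r.

(** Takes coordinates in [T'] to coordinates in [T]. *)
Definition transition T T' (x : X) : 'M[C]_r :=
  col_fun_mx (fun v => triv_coord T (triv_frame T' x v)).

Lemma triv_coord_linear T x : is_local_trivialization T -> triv_dom T x ->
  linear (@triv_coord _ _ _ _ T x).
Proof.
move=> [_ tT _ _] Tx a u v; have [lf fK cK] := tT x Tx.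
by rewrite -{1}(cK u) -{1}(cK v) -lf fK.
Qed.

Lemma transitionE T T' x v : is_local_trivialization T -> is_local_trivialization T' ->
  triv_dom T x -> triv_dom T' x ->
  triv_coord T (triv_frame T' x v) = transition T T' x *m v.
Proof.
move=> tT tT' Tx T'x; apply: (col_fun_mxE (g := fun v => triv_coord T (triv_frame T' x v))).
move=> a u w; have [_ /(_ x T'x) [lf _ _] _ _] := tT'.
by rewrite lf triv_coord_linear.
Qed.

Lemma transitionK T T' x : is_local_trivialization T -> is_local_trivialization T' ->
  triv_dom T x -> triv_dom T' x -> transition T T' x *m transition T' T x = 1%:M.
Proof.
move=> tT tT' Tx T'x; apply/matrixP => i j.
have [_ /(_ x Tx) [_ fK cK] _ _] := tT; have [_ /(_ x T'x) [_ fK' cK'] _ _] := tT'.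
have : transition T T' x *m transition T' T x *m (delta_mx j 0 : 'cV_r)
    = 1%:M *m (delta_mx j 0 : 'cV_r).
  by rewrite -mulmxA -!transitionE// cK' fK mul1mx.
rewrite -!colE => /matrixP/(_ i 0).
by rewrite [in LHS]mxE [in RHS]mxE.
Qed.

Lemma transition_unit T T' x : is_local_trivialization T -> is_local_trivialization T' ->
  triv_dom T x -> triv_dom T' x -> transition T T' x \in unitmx.
Proof. by move=> tT tT' Tx T'x; have /mulmx1_unit[] := transitionK tT tT' Tx T'x. Qed.

End Trivializations.

(** * Regularity of solutions *)

Section Regularity.
Context {R : realType}.
Local Notation C := R[i].
Variables (X : topologicalType) (U : set X) (I : set R) (r : nat).

Lemma uniformly_Ck_leq k k' (f : X -> R -> C) : (k' <= k)%N ->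
  uniformly_Ck U I k f -> uniformly_Ck U I k' f.
Proof.
move=> /subnK <-; elim: (k - k')%N => [|n ih]; first by rewrite add0n.
by rewrite addSn => /uniformly_CkW; exact: ih.
Qed.

Lemma uniformly_Ck_deriv_mx k (W : X -> R -> 'M[C]_r) :
  uniformly_Ck_mx U I k.+1 W -> exists2 dW : X -> R -> 'M[C]_r,
    forall x t, U x -> I t -> has_deriv_mx I (W x) t (dW x t) & uniformly_Ck_mx U I k dW.
Proof.
move=> CW.
have /choice[df dfP] : forall ij : 'I_r * 'I_r, exists df : X -> R -> C,
    (forall x t, U x -> I t -> has_deriv_in I (fun s => W x s ij.1 ij.2) t (df x t)) /\
    uniformly_Ck U I k df.
  by move=> [i j]; have [_ [df dF Cdf]] := CW i j; exists df.
exists (fun x t => \matrix_(i, j) df (i, j) x t).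
  by move=> x t Ux It i j; rewrite mxE; exact: (dfP (i, j)).1.
by move=> i j; apply: eq_uniformly_Ck (dfP (i, j)).2 => x t _ _; rewrite mxE.
Qed.

(** Bootstrapping: if [Phi] is of class C^n with [n < k], then so is its derivative [A *m Phi],
    hence [Phi] is of class C^(n+1). *)
Lemma uniformly_Ck_linear_ode k (A Phi : X -> R -> 'M[C]_r) :
  uniformly_Ck_mx U I k A -> uniformly_Ck_mx U I 0 Phi ->
  (forall x t, U x -> I t -> has_deriv_mx I (Phi x) t (A x t *m Phi x t)) ->
  uniformly_Ck_mx U I k Phi.
Proof.
move=> CA C0 dPhi; suff H n : (n <= k)%N -> uniformly_Ck_mx U I n Phi by exact: H.
elim: n => [//|n ih] nk i j; split; first exact: uniformly_Ck_continuous (C0 i j).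
exists (fun x t => (A x t *m Phi x t) i j); first by move=> x t Ux It; exact: dPhi.
apply: uniformly_Ck_mulmx; last by apply: ih; exact: ltnW.
by move=> a b; apply: uniformly_Ck_leq (CA a b); exact: ltnW.
Qed.

Lemma exists_moser_path k (W : X -> R -> 'M[C]_r) : is_interval I -> I 0 ->
  (forall x, U x -> skew_unit I (W x)) -> uniformly_Ck_mx U I k.+1 W ->
  exists2 Phi : X -> R -> 'M[C]_r,
    forall x, U x -> moser_path I (W x) (Phi x) & uniformly_Ck_mx U I k Phi.
Proof.
move=> itvI I0 skW CW; have [dW hW CdW] := uniformly_Ck_deriv_mx CW.
pose A x t := moser_generator (W x t) (dW x t).
have CA : uniformly_Ck_mx U I k A.
  have CVdW : uniformly_Ck_mx U I k (fun x t => invmx (W x t) *m dW x t).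
    apply: uniformly_Ck_mulmx => //; apply: uniformly_Ck_invmx.
      by move=> x t Ux It; exact: (skW x Ux t It).2.
    by move=> i j; exact: uniformly_CkW (CW i j).
  move=> i j.
  apply: eq_uniformly_Ck (uniformly_CkM (uniformly_Ck_cst U I k (- 2^-1)) (CVdW i j)).
  by move=> x t _ _; rewrite /A /moser_generator [in RHS]mxE.
have [|Phi [Phi0 dPhi CPhi]] := @complex_linear_ode _ _ U I r A itvI I0.
  by move=> i j; exact: uniformly_Ck_leq (leq0n k) (CA i j).
exists Phi; last exact: uniformly_Ck_linear_ode CA CPhi dPhi.
move=> x Ux; exists (dW x); split; [|exact: Phi0|].
  by move=> t It; exact: hW.
by move=> t It; exact: dPhi.
Qed.

End Regularity.

(** * Continuity of fiberwise maps on the total space *)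

Section BundleMaps.
Context {R : realType}.
Local Notation C := R[i].

Lemma cvg_mx (T : Type) (F : set_system T) (FF : Filter F) m n
    (f : T -> 'M[C]_(m, n)) (M : 'M[C]_(m, n)) :
  (forall i j, (fun y => f y i j) @ F --> M i j) -> f @ F --> M.
Proof.
move=> fM P [Q MQ QP].
have : \forall y \near F, forall ij : 'I_m * 'I_n, Q ij.1 ij.2 (f y ij.1 ij.2).
  by apply: filter_forall => -[i j]; exact: (fM i j _ (MQ i j)).
by apply: filterS => y H; apply: QP => i j; exact: (H (i, j)).
Qed.

Lemma cvg_mx_coord (T : Type) (F : set_system T) (FF : Filter F) m n
    (f : T -> 'M[C]_(m, n)) (M : 'M[C]_(m, n)) i j :
  f @ F --> M -> (fun y => f y i j) @ F --> M i j.
Proof.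
move=> fM P nP.
apply: (fM [set N : 'M[C]_(m, n) | P (N i j)]).
exists (fun a b => if (a == i) && (b == j) then P else setT).
  move=> a b; case: ifPn => [/andP[/eqP -> /eqP ->]//|_]; exact: filterT.
by move=> N /= /(_ i j); rewrite !eqxx.
Qed.

Lemma cvg_mulmx (T : Type) (F : set_system T) (FF : Filter F) m n p
    (f : T -> 'M[C]_(m, n)) (g : T -> 'M[C]_(n, p)) (M : 'M[C]_(m, n)) (N : 'M[C]_(n, p)) :
  f @ F --> M -> g @ F --> N -> (fun y => f y *m g y) @ F --> M *m N.
Proof.
move=> fM gN; apply: cvg_mx => i j; rewrite mxE.
rewrite (_ : (fun y => (f y *m g y) i j) = fun y => \sum_l f y i l * g y l j); last first.
  by apply/funext => y; rewrite mxE.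
elim: (index_enum _) => [|l s ih].
  rewrite big_nil (_ : (fun y => _) = fun _ => 0); first exact: cvg_complex_cst.
  by apply/funext => y; rewrite big_nil.
rewrite big_cons (_ : (fun y => _) =
  fun y => f y i l * g y l j + \sum_(l <- s) f y i l * g y l j).
  exact: (cvg_complexD (cvg_complexM (@cvg_mx_coord _ _ FF _ _ _ _ i l fM)
    (@cvg_mx_coord _ _ FF _ _ _ _ l j gN)) ih).
by apply/funext => y; rewrite big_cons.
Qed.

Lemma cvg_to_within (T : Type) (Y : topologicalType) (F : set_system T) (FF : Filter F)
    (A : set Y) (h : T -> Y) (y : Y) :
  h @ F --> y -> (\forall q \near F, A (h q)) -> h @ F --> within A (nbhs y).
Proof.
move=> hy hA P; rewrite /within/= => /hy nP.
by apply: filterS2 hA nP => q Aq; apply.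
Qed.

Variables (X : topologicalType) (r : nat) (V : complexVectorBundle R X r) (I : set R).
Implicit Types T : trivialization V r.

Definition endo_matrix (H : endo_family V) T (M : X -> R -> 'M[C]_r) : Prop :=
  forall x t (u : fs_fiber V x), triv_dom T x -> I t ->
    triv_coord T (H t x u) = M x t *m triv_coord T u.

(** Near a point of the total space the family is the composite of three continuous maps: taking
    coordinates in one trivialization, multiplying by the matrix, and returning through the
    frame. *)
Lemma endo_matrix_continuous (H : endo_family V) :
  (forall T, is_local_trivialization T ->
    exists2 M, endo_matrix H T M & uniformly_Ck_mx (triv_dom T) I 0 M) ->
  continuous_endo I H.
Proof.
move=> HM; apply/subspace_continuousP => -[e0 t0] [_ /= It0].
have [T tT Te0] := vb_trivial V (fs_proj e0).
have [M HE CM] := HM T tT.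
have [oT bT cframe ccoord] := tT.
pose D := setT `*` I : set (fs_total V * R).
pose F := within D (nbhs (e0, t0)).
pose g (p : X * 'cV[C]_r) := fs_pt (triv_frame T p.1 p.2).
pose phi (q : fs_total V * R) : X * 'cV[C]_r :=
  (fs_proj q.1, M (fs_proj q.1) q.2 *m triv_coord T (fs_vec q.1)).
have FE : (fun q : fs_total V * R => fs_pt (H q.2 _ (fs_vec q.1))) (e0, t0) = g (phi (e0, t0)).
  by rewrite /g /= -HE//; have [_ _ ->] := bT _ Te0.
have FF : Filter F by exact: within_filter.
have FD : \forall q \near F, D q by exact: withinT.
have fstF : (fun q : fs_total V * R => q.1) @ F --> e0.
  exact: (cvg_trans (cvg_app _ (@cvg_within _ _ _ _)) cvg_fst).
have sndF : (fun q : fs_total V * R => q.2) @ F --> t0.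
  exact: (cvg_trans (cvg_app _ (@cvg_within _ _ _ _)) cvg_snd).
have projF : (fun q : fs_total V * R => fs_proj q.1) @ F --> fs_proj e0.
  exact: (cvg_comp _ _ fstF (@fs_proj_continuous _ _ V e0)).
have domF : \forall q \near F, triv_dom T (fs_proj q.1).
  exact: (projF _ (open_nbhs_nbhs (conj oT Te0))).
have IF : \forall q \near F, I q.2 by apply: filterS FD => q [].
have MF : (fun q : fs_total V * R => M (fs_proj q.1) q.2) @ F --> M (fs_proj e0) t0.
  apply: cvg_mx => i j.
  have [/subspace_continuousP cM _] := CM i j.
  have pairF : (fun q : fs_total V * R => (fs_proj q.1, q.2)) @ F
      --> within (triv_dom T `*` I) (nbhs (fs_proj e0, t0)).
    apply: (cvg_to_within FF); first exact: (cvg_pair projF sndF).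
    by apply: filterS2 domF IF => q Tq Iq; split.
  exact: (cvg_comp _ _ pairF (cM (fs_proj e0, t0) (conj Te0 It0))).
have coordF : (fun q : fs_total V * R => triv_coord T (fs_vec q.1)) @ F
    --> triv_coord T (fs_vec e0).
  have e0F := cvg_to_within FF (A := @fs_proj _ _ V @^-1` triv_dom T) fstF domF.
  by move/subspace_continuousP : ccoord => /(_ e0 Te0); exact: (cvg_comp _ _ e0F).
have phiF : phi @ F --> within (triv_dom T `*` setT) (nbhs (phi (e0, t0))).
  apply: (cvg_to_within FF); last by apply: filterS domF => q Tq; split.
  exact: (cvg_pair projF (cvg_mulmx FF MF coordF)).
move/subspace_continuousP : cframe => /(_ (phi (e0, t0)) (conj Te0 Logic.I)) gF.
suff : (fun q : fs_total V * R => fs_pt (H q.2 _ (fs_vec q.1))) @ F --> g (phi (e0, t0)).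
  by rewrite -FE.
(* The composite agrees with the family only over [triv_dom T] and for times in [I], which holds
   eventually along the filter. *)
apply: cvg_trans (cvg_comp _ _ phiF gF).
apply: near_eq_cvg; apply: filterS2 domF IF => -[e t] /= Te It.
have [_ _ cK] := bT _ Te; rewrite /g /phi /= -HE//.
exact: (congr1 (@fs_pt _ _ V (fs_proj e)) (cK _)).
Qed.

End BundleMaps.

Lemma continuous_endo_bundle_map (R : realType) (X : topologicalType) (r : nat)
    (V : complexVectorBundle R X r) (I : set R) (H : endo_family V) t :
  I t -> continuous_endo I H -> continuous (bundle_map (H t)).
Proof.
move=> It /subspace_continuousP cH e.
have inF : (fun e' : fs_total V => (e', t)) @ e --> within (setT `*` I) (nbhs (e, t)).
  apply: (cvg_to_within (nbhs_filter e)); last by apply: nearW.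
  exact: (cvg_pair cvg_id (cvg_cst _)).
exact: (cvg_comp _ _ inF (cH (e, t) (conj Logic.I It))).
Qed.

Lemma adjmx_delta_mulmx (R : realType) n (M : 'M[R[i]]_n) i j :
  (adjmx (delta_mx i 0 : 'cV_n) *m M *m (delta_mx j 0 : 'cV_n)) 0 0 = M i j.
Proof.
have -> : adjmx (delta_mx i 0 : 'cV[R[i]]_n) = delta_mx 0 i.
  by apply/matrixP => a b; rewrite adjmxE !mxE rmorph_nat andbC.
by rewrite -rowE -colE !mxE.
Qed.

(** * Construction of the bundle isomorphisms *)

Section Moser.
Context {R : realType}.
Local Notation C := R[i].
Variables (X : topologicalType) (r : nat) (V : complexVectorBundle R X r) (I : set R).
Variables (omega : form_family V) (k : nat).
Hypotheses (itvI : is_interval I) (nI : nbhs (0 : R) I).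
Hypothesis omega_symp : forall t (x : X), I t -> hermitian_symplectic (@omega t x).
Hypothesis omega_Ck : uniformly_Ck_form I k.+1 omega.
Implicit Types T : trivialization V r.

Let I0 : I 0. Proof. exact: nbhs_singleton nI. Qed.

Let W T (x : X) (t : R) : 'M[C]_r := gram_mx (@omega t x) (triv_frame T x).

Let omegaE T x t u v : is_local_trivialization T -> triv_dom T x -> I t ->
  @omega t x (triv_frame T x u) (triv_frame T x v) = (adjmx u *m W T x t *m v) 0 0.
Proof.
move=> [_ tT _ _] Tx It; have [lf _ _] := tT x Tx.
exact: (gram_mxE (omega_symp x It) lf).
Qed.

Let W_skew T x : is_local_trivialization T -> triv_dom T x -> skew_unit I (W T x).
Proof.
move=> [_ tT _ _] Tx t It; have [lf fK cK] := tT x Tx; split.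
  exact: (gram_mx_skew _ (omega_symp x It)).
exact: (gram_mx_unit (omega_symp x It) lf fK cK).
Qed.

(** Gram matrices of one form in two frames are congruent through the transition matrix, which does
    not depend on [t]. This is the situation of [moser_path_conj]. *)
Let W_transition T T' x t : is_local_trivialization T -> is_local_trivialization T' ->
  triv_dom T x -> triv_dom T' x -> I t ->
  adjmx (transition T T' x) *m W T x t *m transition T T' x = W T' x t.
Proof.
move=> tT tT' Tx T'x It; apply/matrixP => i j.
have [_ /(_ x Tx) [_ _ cK] _ _] := tT.
have frameE v : triv_frame T' x v = triv_frame T x (transition T T' x *m v).
  by rewrite -transitionE.
rewrite [RHS]mxE !frameE omegaE// adjmxM !mulmxA.
by rewrite -(mulmxA _ _ (W T x t)) -[in RHS](mulmxA _ _ (transition T T' x)) adjmx_delta_mulmx.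
Qed.

Lemma moser_trick : exists F : endo_family V,
  [/\ forall t, I t -> bundle_isomorphism (F t),
      continuous_endo I F,
      uniformly_Ck_endo I k F &
      [/\ forall t, I t -> forall (x : X) (u v : fs_fiber V x),
            pullback (F t) (@omega t) u v = @omega 0 x u v,
          forall (x : X) (u : fs_fiber V x), F 0 x u = u &
          form_deriv0 I omega -> endo_deriv0 I F]].
Proof.
(* One solution for each trivialization; the zero matrix is a default where [T] is not a local
   trivialization. *)
have /choice[Phi PhiP] : forall T, exists Phi : X -> R -> 'M[C]_r, is_local_trivialization T ->
    (forall x, triv_dom T x -> moser_path I (W T x) (Phi x)) /\
    uniformly_Ck_mx (triv_dom T) I k Phi.
  move=> T; have [tT|nT] := pselect (is_local_trivialization T); last by exists (fun _ _ => 0).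
  have [||Phi mPhi CPhi] := @exists_moser_path _ X (triv_dom T) I r k (W T) itvI I0.
  - by move=> x Tx; exact: W_skew.
  - by move=> i j; apply: eq_uniformly_Ck (omega_Ck tT i j) => x t _ _; rewrite mxE.
  by exists Phi.
have /choice[Tx TxP] : forall x : X, exists T, is_local_trivialization T /\ triv_dom T x.
  by move=> x; have [T tT Tx] := vb_trivial V x; exists T.
have tTx x : is_local_trivialization (Tx x) by exact: (TxP x).1.
have Txx x : triv_dom (Tx x) x by exact: (TxP x).2.
have frame_lin T x : is_local_trivialization T -> triv_dom T x ->
    linear (@triv_frame _ _ _ _ T x).
  by move=> [_ tT _ _] /tT[].
have frameK T x : is_local_trivialization T -> triv_dom T x ->
    cancel (@triv_frame _ _ _ _ T x) (@triv_coord _ _ _ _ T x).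
  by move=> [_ tT _ _] /tT[].
have coordK T x : is_local_trivialization T -> triv_dom T x ->
    cancel (@triv_coord _ _ _ _ T x) (@triv_frame _ _ _ _ T x).
  by move=> [_ tT _ _] /tT[].
have uPhi T x t : is_local_trivialization T -> triv_dom T x -> I t -> Phi T x t \in unitmx.
  move=> tT Tx0 It.
  exact: (moser_path_unit itvI nI (W_skew tT Tx0) ((PhiP T tT).1 x Tx0) It).
(* The conjugate of the solution in [T] solves the equation in [T'] at [x], so uniqueness identifies
   it with the solution in [T']. *)
have Phi_transition T T' x t : is_local_trivialization T -> is_local_trivialization T' ->
    triv_dom T x -> triv_dom T' x -> I t ->
    Phi T' x t = invmx (transition T T' x) *m Phi T x t *m transition T T' x.
  move=> tT tT' Tx0 T'x It.
  suff mP : moser_path I (W T' x)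
      (fun s => invmx (transition T T' x) *m Phi T x s *m transition T T' x).
    exact: (moser_path_unique itvI nI (W_skew tT' T'x) ((PhiP T' tT').1 x T'x) mP It).
  have WT s : I s -> W T x s \in unitmx by move=> Is; exact: (W_skew tT Tx0 Is).2.
  have [dW [hW Psi0 dPsi]] :=
    moser_path_conj (transition_unit tT tT' Tx0 T'x) WT ((PhiP T tT).1 x Tx0).
  exists dW; split; [|exact: Psi0|].
    move=> s Is; apply: (has_deriv_mx_ext Is _ (hW s Is)) => s' Is'.
    exact: W_transition.
  move=> s Is; have := dPsi s Is; rewrite W_transition//.
pose F : endo_family V := fun t x u =>
  triv_frame (Tx x) x (Phi (Tx x) x t *m triv_coord (Tx x) u).
pose Finv : endo_family V := fun t x u =>
  triv_frame (Tx x) x (invmx (Phi (Tx x) x t) *m triv_coord (Tx x) u).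
(* This removes the dependence on the chosen [Tx x]: over its whole domain, every trivialization
   represents [F] by its own solution, which is continuous in the base point. *)
have FE T : is_local_trivialization T -> endo_matrix I F T (Phi T).
  move=> tT x t u Tx0 It.
  have tK := transitionK (tTx x) tT (Txx x) Tx0.
  have utr := transition_unit (tTx x) tT (Txx x) Tx0.
  have invE : invmx (transition (Tx x) T x) = transition T (Tx x) x.
    by apply: (can_inj (mulKmx utr)); rewrite tK mulmxV.
  rewrite /F (transitionE _ tT (tTx x) Tx0 (Txx x)).
  rewrite (Phi_transition (Tx x) T x t (tTx x) tT (Txx x) Tx0 It) invE.
  rewrite -[in LHS](coordK T x tT Tx0 u) (transitionE _ (tTx x) tT (Txx x) Tx0).
  by rewrite !mulmxA.
have Fcoord x t u : I t -> triv_coord (Tx x) (F t x u) = Phi (Tx x) x t *m triv_coord (Tx x) u.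
  by move=> It; rewrite /F frameK.
have FK t x : I t -> cancel (F t x) (Finv t x).
  by move=> It u; rewrite /Finv Fcoord// mulKmx ?uPhi// coordK.
have FinvK t x : I t -> cancel (Finv t x) (F t x).
  by move=> It u; rewrite /F /Finv frameK// mulKVmx ?uPhi// coordK.
(* Needed for continuity of the inverse bundle maps: inversion of matrices preserves continuous
   families. *)
have FinvE T : is_local_trivialization T -> endo_matrix I Finv T (fun x t => invmx (Phi T x t)).
  move=> tT x t u Tx0 It; apply: (canRL (mulKmx (uPhi T x t tT Tx0 It))).
  by rewrite -(FE T)// FinvK.
have C0 T : is_local_trivialization T -> uniformly_Ck_mx (triv_dom T) I 0 (Phi T).
  by move=> tT i j; exact: uniformly_Ck_leq (leq0n k) ((PhiP T tT).2 i j).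
have F_cont : continuous_endo I F.
  by apply: endo_matrix_continuous => T tT; exists (Phi T); [exact: FE|exact: C0].
have Finv_cont : continuous_endo I Finv.
  apply: endo_matrix_continuous => T tT; exists (fun x t => invmx (Phi T x t)).
    exact: FinvE.
  by apply: uniformly_Ck_invmx; [move=> x t Tx0 It; exact: uPhi|exact: C0].
exists F; split.
- move=> t It; split.
  + move=> x a u v; rewrite /F (triv_coord_linear (tTx x) (Txx x)).
    by rewrite mulmxDr -scalemxAr frame_lin.
  + exact: continuous_endo_bundle_map F_cont.
  exists (Finv t); split.
  + by move=> x; exact: FK.
  + by move=> x; exact: FinvK.
  exact: continuous_endo_bundle_map Finv_cont.
- exact: F_cont.
- move=> T tT i j; apply: eq_uniformly_Ck ((PhiP T tT).2 i j) => x t Tx0 It.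
  rewrite /endo_coef (FE T)// frameK//.
  by rewrite -colE mxE.
split.
- move=> t It x u v; rewrite /pullback /F omegaE//.
  rewrite -{2}(coordK _ x (tTx x) (Txx x) u) -{2}(coordK _ x (tTx x) (Txx x) v) omegaE//.
  have mP := (PhiP _ (tTx x)).1 x (Txx x).
  rewrite -(moser_path_cst itvI nI (W_skew (tTx x) (Txx x)) mP mP It).
  by rewrite adjmxM !mulmxA.
- move=> x u; have [dW [_ Phi0 _]] := (PhiP _ (tTx x)).1 x (Txx x).
  by rewrite /F Phi0 mul1mx coordK.
move=> omega0 T tT x u i Tx0.
(* The entries of the Gram matrix are values of the form on frame vectors, so its derivative at 0
   vanishes entrywise. *)
have W0 : has_deriv_mx I (W T x) 0 0.
  move=> a b; rewrite mxE.
  apply: has_deriv_in_ext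
    (omega0 x (triv_frame T x (delta_mx a 0)) (triv_frame T x (delta_mx b 0))) => // s Is.
  by rewrite mxE.
have dPhi := moser_path_deriv0 itvI nI ((PhiP T tT).1 x Tx0) W0.
have := has_deriv_mxM dPhi (has_deriv_mx_cst I (triv_coord T u) 0).
rewrite mul0mx add0r mulmx0 => /(_ i 0); rewrite mxE.
by apply: has_deriv_in_ext => // s Is; rewrite (FE T).
Qed.

End Moser.

Theorem theorem4p1 (R : realType) (X : smoothManifold R) (d : nat)
  (V : complexVectorBundle R X (2 * d)%N) (I : set R)
  (I_itv : is_interval I) (I_nbhs0 : nbhs (0 : R) I)
  (omega : form_family V)
  (omega0 : forall x : X, fs_fiber V x -> fs_fiber V x -> R[i])
  (omega_symp : forall t (x : X), I t -> hermitian_symplectic (omega t x))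
  (l : nat) (l_ge2 : (2 <= l)%N)
  (omega_cont : continuous_form I omega)
  (omega_Cl : uniformly_Ck_form I l omega)
  (omega_0 : forall (x : X) (u v : fs_fiber V x), omega 0 x u v = omega0 x u v)
  (omega_deriv0 : form_deriv0 I omega) :
  exists F : endo_family V,
    [/\ forall t, I t -> bundle_isomorphism (F t),
        continuous_endo I F,
        uniformly_Ck_endo I l.-1 F &
        [/\ forall t, I t -> forall (x : X) (u v : fs_fiber V x),
              pullback (F t) (omega t) u v = omega0 x u v,
            forall (x : X) (u : fs_fiber V x), F 0 x u = u &
            endo_deriv0 I F]].
Proof.
(* With [l = k.+1], the order [l.-1] is the [k] that remains after the loss of one derivative. *)
case: l l_ge2 omega_Cl => // k _ Ck.
have [F [F_iso F_cont F_Ck [F_pull F_0 F_deriv0]]] := moser_trick I_itv I_nbhs0 omega_symp Ck.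
exists F; split; [exact: F_iso|exact: F_cont|exact: F_Ck|].
split; [|exact: F_0|exact: F_deriv0].
by move=> t It x u v; rewrite F_pull// omega_0.
Qed.
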